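(* Assume $g=0$ and let $v^{\mathrm{in}}\in\mathbb{L}^2(\mathcal{O})$, with $(v^n_{\mathcal{D}})_{n\in\mathbb{N}_0}$ the discrete velocity generated by the algorithm initialised in $v^{\mathrm{in}}$. For $N\in\mathbb{N}$ and Borel $A\subset\mathbb{L}^2(\mathcal{O})$ let $$\mu^N_{\tau,\mathcal{D}}(v^{\mathrm{in}};A)=\frac1N\sum_{n=0}^{N-1}\mathbb{P}(\Pi_{\mathcal{D}}v^n_{\mathcal{D}}\in A),\qquad \mu^{1/2,N}_{\tau,\mathcal{D}}(v^{\mathrm{in}};A)=\frac1N\sum_{n=0}^{N-1}\mathbb{P}(\Pi_{\mathcal{D}}v^{n+1/2}_{\mathcal{D}}\in A).$$ Then the following statements are true: (a) the $\mathcal{P}_{\tau,\mathcal{D}}$-invariant (probability) measure is the Dirac measure $\delta_0$ supported at zero velocity; (b) $\lim_{n\to\infty}\Pi_{\mathcal{D}}v^n_{\mathcal{D}}=0$ in $L^2(\mathcal{O})$, $\mathbb{P}$-a.s.; (c) $\lim_{n\to\infty}\Pi_{\mathcal{D}}v^{n+1/2}_{\mathcal{D}}=0$ in $L^2(\mathcal{O})$, $\mathbb{P}$-a.s.; (d) $\lim_{N\to\infty}\mu^N_{\tau,\mathcal{D}}(v^{\mathrm{in}};\cdot)=\delta_0$ in the sense of weak convergence of measures; (e) $\lim_{N\to\infty}\mu^{1/2,N}_{\tau,\mathcal{D}}(v^{\mathrm{in}};\cdot)=\delta_0$ in the sense of weak convergence of measures.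
   Context: Setting. $(\Omega,(\mathcal{F}_t)_{t\ge0},\mathcal{F},\mathbb{P})$ is a filtered probability space satisfying the usual conditions and $W$ is a real-valued $(\mathcal{F}_t)$-Wiener process. $\mathcal{O}\subset\mathbb{R}^d$ is a bounded polygonal domain. $p\in(1,\infty)$, $p'=p/(p-1)$, $p\wedge p'=\min(p,p')$, $\kappa\ge0$. For $A\in\mathbb{R}^{d\times d}$ (with Euclidean norm $|A|$), $S(A)=(\kappa+|A|^2)^{(p-2)/2}A$ (with $S(0)=0$). $\mathbb{L}^2(\mathcal{O})$ is the space of $L^2$ vector fields $\mathcal{O}\to\mathbb{R}^d$, and $C_b(\mathbb{L}^2(\mathcal{O}))$ the space of (norm-)continuous bounded real functions on it; $(\cdot,\cdot)$ is the $L^2(\mathcal{O})$ pairing $\int_{\mathcal{O}}$ of (scalar, vector or matrix) functions. $\mathbb{W}^{k,\infty}_{\mathrm{div}}(\mathcal{O})$ is the $W^{k,\infty}$-closure of smooth vector fields on $\mathcal{O}$ with zero divergence. The data are deterministic and time-independent: in general $g\in\mathbb{W}^{2,\infty}_{\mathrm{div}}(\mathcal{O})$ (here $g=0$), $\sigma\in\mathbb{W}^{1,\infty}_{\mathrm{div}}(\mathcal{O})$. $\varepsilon g=\tfrac12(\nabla g+(\nabla g)^T)$ and $(\sigma\cdot\nabla)g=\sum_j\sigma_j\partial_jg$. Gradient Discretisation (GD). $\mathcal{D}=(X_{\mathcal{D},0},Y_{\mathcal{D}},\nabla_{\mathcal{D}},\varepsilon_{\mathcal{D}},\chi_{\mathcal{D}},\mathrm{div}_{\mathcal{D}},\Pi_{\mathcal{D}})$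 where $X_{\mathcal{D},0},Y_{\mathcal{D}}$ are finite-dimensional real vector spaces; $\nabla_{\mathcal{D}},\varepsilon_{\mathcal{D}}:X_{\mathcal{D},0}\to L^p(\mathcal{O})^{d\times d}$, $\mathrm{div}_{\mathcal{D}}:X_{\mathcal{D},0}\to L^p(\mathcal{O})$, $\Pi_{\mathcal{D}}:X_{\mathcal{D},0}\to L^2(\mathcal{O})^d$, $\chi_{\mathcal{D}}:Y_{\mathcal{D}}\to L^{p\wedge p'}(\mathcal{O})$ are linear; $\nabla_{\mathcal{D}},\varepsilon_{\mathcal{D}},\mathrm{div}_{\mathcal{D}},\Pi_{\mathcal{D}}$ moreover take values in $L^p\cap L^{p'}$, so that all pairings and constants below make sense. $\|\varepsilon_{\mathcal{D}}\cdot\|_{L^p(\mathcal{O})}$ is a norm on $X_{\mathcal{D},0}$. With $Y_{\mathcal{D},0}=\{q\in Y_{\mathcal{D}}:\int_{\mathcal{O}}\chi_{\mathcal{D}}q\,dx=0\}$, $\|\chi_{\mathcal{D}}\cdot\|_{L^{p\wedge p'}(\mathcal{O})}$ is a norm on $Y_{\mathcal{D},0}$. $E_{\mathcal{D},0}=\{v\in X_{\mathcal{D},0}:(\chi_{\mathcal{D}}q,\mathrm{div}_{\mathcal{D}}v)=0\ \forall q\in Y_{\mathcal{D},0}\}$, and $\Pi_{\mathcal{D}}$ is one-to-one on $E_{\mathcal{D},0}$. The $L^2$-projection $\mathcal{K}_{\mathcal{D}}:\mathbb{L}^2(\mathcal{O})\to E_{\mathcal{D},0}$ is defined by $(u-\Pi_{\mathcal{D}}\mathcal{K}_{\mathcal{D}}u,\Pi_{\mathcal{D}}\xi)=0$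 for all $\xi\in E_{\mathcal{D},0}$. For $r\in\{p,p'\}$ put $C_{\mathcal{D}}(r)=\sup_{v\in X_{\mathcal{D},0}\setminus\{0\}}\frac{\|\Pi_{\mathcal{D}}v\|_{L^r}+\|\mathrm{div}_{\mathcal{D}}v\|_{L^r}+\|\nabla_{\mathcal{D}}v\|_{L^r}}{\|\varepsilon_{\mathcal{D}}v\|_{L^r}}$, $C^{\mathrm{Sob}}_{\mathcal{D}}(r)=\sup_{z\in W^{1,r}(\mathcal{O})^d\setminus\{0\}}\frac{\|\varepsilon_{\mathcal{D}}\mathcal{K}_{\mathcal{D}}z\|_{L^r}}{\|z\|_{W^{1,r}}}$, and $\beta_{\mathcal{D}}(p)=\inf_{q\in Y_{\mathcal{D},0}\setminus\{0\}}\sup_{v\in X_{\mathcal{D},0}\setminus\{0\}}\frac{(\chi_{\mathcal{D}}q,\mathrm{div}_{\mathcal{D}}v)}{\|\chi_{\mathcal{D}}q\|_{L^{p\wedge p'}}(\|\varepsilon_{\mathcal{D}}v\|_{L^p}+\|\varepsilon_{\mathcal{D}}v\|_{L^{p'}})}$. Standing assumption: $\mathcal{D}$ is $\Gamma$-stable, i.e. for some $\Gamma\in[1,\infty)$: $C_{\mathcal{D}}(p)+C_{\mathcal{D}}(p')\le\Gamma$, $\beta_{\mathcal{D}}(p)\ge\Gamma^{-1}$, $C^{\mathrm{Sob}}_{\mathcal{D}}(p)+C^{\mathrm{Sob}}_{\mathcal{D}}(p')\le\Gamma$. Discrete noise form: $B^\sigma_{\mathcal{D}}(v,\xi)=\tfrac12(\sigma^T\nabla_{\mathcal{D}}v,\Pi_{\mathcal{D}}\xi)-\tfrac12(\Pi_{\mathcal{D}}v,\sigma^T\nabla_{\mathcal{D}}\xi)$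 for $v,\xi\in X_{\mathcal{D},0}$, where $(\sigma^T\nabla_{\mathcal{D}}v)_i=\sum_j\sigma_j(\nabla_{\mathcal{D}}v)_{ji}$ is the discrete counterpart of $(\sigma\cdot\nabla)v$. Algorithm. Given $v^{\mathrm{in}}\in\mathbb{L}^2(\mathcal{O})$ and a fixed time step $\tau>0$, $t_n=n\tau$, $\Delta_{n+1}W=W(t_{n+1})-W(t_n)$. Step 1 (initialisation): $(v^0_{\mathcal{D}},\pi^0_{\mathcal{D}})\in X_{\mathcal{D},0}\times Y_{\mathcal{D},0}$ solves $(\Pi_{\mathcal{D}}v^0_{\mathcal{D}},\Pi_{\mathcal{D}}\xi)+(\chi_{\mathcal{D}}\pi^0_{\mathcal{D}},\mathrm{div}_{\mathcal{D}}\xi)=(v^{\mathrm{in}},\Pi_{\mathcal{D}}\xi)$ for all $\xi\in X_{\mathcal{D},0}$ and $(\mathrm{div}_{\mathcal{D}}v^0_{\mathcal{D}},\chi_{\mathcal{D}}q)=0$ for all $q\in Y_{\mathcal{D},0}$. Step 2 (time-stepping): for $n\in\mathbb{N}_0$, $(v^{n+1}_{\mathcal{D}},\pi^{n+1}_{\mathcal{D}})\in X_{\mathcal{D},0}\times Y_{\mathcal{D},0}$ satisfies $\mathbb{P}$-a.s. for all $(\xi,q)\in X_{\mathcal{D},0}\times Y_{\mathcal{D},0}$ $$(\Pi_{\mathcal{D}}v^{n+1}_{\mathcal{D}}-\Pi_{\mathcal{D}}v^n_{\mathcal{D}},\Pi_{\mathcal{D}}\xi)+\tau(S(\varepsilon_{\mathcal{D}}v^{n+1/2}_{\mathcal{D}}+\varepsilon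 g),\varepsilon_{\mathcal{D}}\xi)-(\chi_{\mathcal{D}}\pi^{n+1}_{\mathcal{D}}-\chi_{\mathcal{D}}\pi^n_{\mathcal{D}},\mathrm{div}_{\mathcal{D}}\xi)=[B^\sigma_{\mathcal{D}}(v^{n+1/2}_{\mathcal{D}},\xi)+((\sigma\cdot\nabla)g,\Pi_{\mathcal{D}}\xi)]\Delta_{n+1}W,$$ $$(\mathrm{div}_{\mathcal{D}}v^{n+1/2}_{\mathcal{D}},\chi_{\mathcal{D}}q)=0,\qquad v^{n+1/2}_{\mathcal{D}}=\tfrac12(v^{n+1}_{\mathcal{D}}+v^n_{\mathcal{D}}).$$ The algorithm is well-posed (unique solutions). Solution operator: $\mathfrak{S}(n,v^{\mathrm{in}}):=v^n_{\mathcal{D}}\in E_{\mathcal{D},0}$, the velocity at index $n$ when initialised in $v^{\mathrm{in}}$. Discrete transition semigroup: $(\mathcal{P}^n_{\tau,\mathcal{D}}f)(v^{\mathrm{in}})=\mathbb{E}[f(\Pi_{\mathcal{D}}\mathfrak{S}(n,v^{\mathrm{in}}))]$ for $n\in\mathbb{N}_0$, $f\in C_b(\mathbb{L}^2(\mathcal{O}))$, $v^{\mathrm{in}}\in\mathbb{L}^2(\mathcal{O})$. A measure $\mu$ on $\mathbb{L}^2(\mathcal{O})$ is invariant with respect to $\mathcal{P}_{\tau,\mathcal{D}}$ if $\int(\mathcal{P}^n_{\tau,\mathcal{D}}f)(v)\,\mu(dv)=\int f(v)\,\mu(dv)$ for all $n\in\mathbb{N}$ and $f\in C_b(\mathbb{L}^2(\mathcal{O}))$.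 *)

(* Defs.v *)
From HB Require Import structures.
From mathcomp Require Import all_boot all_order all_algebra.
From mathcomp Require Import all_classical all_reals all_analysis.
From mathcomp Require Import ess_sup_inf measurable_realfun.

Set Implicit Arguments.
Unset Strict Implicit.
Unset Printing Implicit Defensive.
Import Order.TTheory GRing.Theory Num.Theory.
Import numFieldNormedType.Exports.

Local Open Scope classical_set_scope.
Local Open Scope ring_scope.

(* R^d is 'rV[R]_d, with the product sigma-algebra, which is also the Borel
   one by open_measurable_rV below. *)

Definition measure_mx_display : measure_display.
Proof. exact. Qed.

Section matrix_measurable.
Context {R : realType} (m n : nat).

Definition mx_cylinders : set_system 'M[R]_(m, n) :=
  [set A | exists i j, exists2 B : set R,
     measurable B & A = [set M : 'M[R]_(m, n) | B (M i j)]].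

HB.instance Definition _ := @isMeasurable.Build measure_mx_display
  'M[R]_(m, n) <<s mx_cylinders >> (@sigma_algebra0 _ _ _)
  (@sigma_algebraC _ _) (@sigma_algebra_bigcup _ _ _).

Lemma measurable_entry i j :
  measurable_fun setT (fun M : 'M[R]_(m, n) => M i j).
Proof.
move=> _ B mB; rewrite setTI; apply: sub_sigma_algebra.
by exists i, j, B.
Qed.

Lemma measurable_fun_mxP d (T : measurableType d) (f : T -> 'M[R]_(m, n)) :
  (forall i j, measurable_fun setT (fun x => f x i j)) -> measurable_fun setT f.
Proof.
move=> mf; apply: (measurability mx_cylinders) => //.
move=> _ [_ [i [j [B mB ->]]] <-]; exact: (mf i j measurableT B mB).
Qed.

End matrix_measurable.

Lemma open_measurable_rV (R : realType) (d : nat) (U : set 'rV[R]_d) :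
  open U -> measurable U.
Proof.
move=> oU.
pose box (c : 'rV[rat]_d * nat) : set 'rV[R]_d :=
  [set x | forall j, `|ratr (c.1 0 j) - x 0 j| < c.2.+1%:R^-1].
have mbox c : measurable (box c).
  have -> : box c = \bigcap_(j in [set: 'I_d])
      ((fun x : 'rV[R]_d => x 0 j) @^-1`
        [set r | `|ratr (c.1 0 j) - r| < c.2.+1%:R^-1]).
    apply/seteqP; split=> x /= H j; first by move=> _; exact: H.
    exact: (H j).
  apply: fin_bigcap_measurable => // j _.
  rewrite -[X in measurable X]setTI; apply: measurable_entry => //.
  apply: open_measurable.
  exact: (@ball_open R R^o (ratr (c.1 0 j)) c.2.+1%:R^-1).
have -> : U = \bigcup_(c in [set c | box c `<=` U]) box c.
  apply/seteqP; split=> [x Ux|x [c /= cU cx]]; last exact: cU.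
  have /nbhs_ballP[e /= e0 eU] : nbhs x U by exact: open_nbhs_nbhs.
  have [k ke] : exists k : nat, k.+1%:R^-1 < e / 2.
    have e20 : 0 < e / 2 by rewrite divr_gt0.
    have [k _ kP] := near_infty_natSinv_lt (PosNum e20).
    by exists k; exact: (kP k (leqnn k)).
  have H j : exists q : rat, `|ratr q - x 0 j| < k.+1%:R^-1.
    have k0 : (0 : R) < k.+1%:R^-1 by rewrite invr_gt0.
    have /rat_in_itvoo[q] : x 0 j - k.+1%:R^-1 < x 0 j + k.+1%:R^-1.
      by rewrite ltrBlDr -addrA ltrDl addr_gt0.
    by rewrite in_itv/= => qP; exists q; rewrite ltr_distl.
  have /choice[q qP] := H.
  exists (\row_j q j, k) => /=; last by move=> j/=; rewrite mxE.
  move=> y /= yP; apply: eU => /=; split=> // i j; rewrite (ord1 i).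
  rewrite /ball /=; have := yP j; rewrite mxE => {}yP.
  rewrite (splitr e) (le_lt_trans (ler_distD (ratr (q j)) _ _))//.
  by rewrite ltrD// (lt_trans _ ke)// distrC.
rewrite bigcup_mkcond; apply: countable_bigcupT_measurable => // c.
by case: ifP => _; [exact: mbox|exact: measurable0].
Qed.

Section lebesgue_rV.
Context {R : realType}.

Definition rV_cons (n : nat) (av : R * 'rV[R]_n) : 'rV[R]_n.+1 :=
  \row_j if unlift ord0 j is Some k then av.2 0 k else av.1.

Lemma measurable_rV_cons n : measurable_fun setT (@rV_cons n).
Proof.
apply: measurable_fun_mxP => i j; rewrite /rV_cons.
under eq_fun do rewrite mxE.
case: (unlift ord0 j) => [k|]; last exact: measurable_fst.
exact: (measurableT_comp (measurable_entry 0 k) measurable_snd).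
Qed.

(* d-dimensional Lebesgue measure, by iterated products. *)
Fixpoint lebesgue_rV (n : nat) : {measure set 'rV[R]_n -> \bar R} :=
  match n with
  | 0 => \d_(0 : 'rV[R]_0)
  | k.+1 => measure_function_pushforward__canonical__measure_function_Measure
      (@lebesgue_measure R \x^ lebesgue_rV k)%E (@measurable_rV_cons k)
  end.

End lebesgue_rV.

Section domain.
Context {R : realType} (d : nat).

Definition simplex (a : 'I_d.+1 -> 'rV[R]_d) : set 'rV[R]_d :=
  [set x | exists2 l : 'I_d.+1 -> R,
     (forall i, 0 <= l i) /\ \sum_i l i = 1 & x = \sum_i l i *: a i].

(* A bounded polygonal domain: nonempty, connected, and the interior of a
   finite union of simplices (so open and bounded). *)
Definition polygonal (O : set 'rV[R]_d) : Prop :=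
  [/\ O !=set0, connected O &
      exists k (a : 'I_k -> 'I_d.+1 -> 'rV[R]_d),
        O = interior (\bigcup_(i in [set: 'I_k]) simplex (a i))].

Record polydom := PolyDom {
  dom :> set 'rV[R]_d ;
  domP : polygonal dom
}.

Lemma dom_measurable (O : polydom) : measurable (O : set 'rV[R]_d).
Proof.
have [_ _ [k [a ->]]] := domP O.
by apply: open_measurable_rV; exact: open_interior.
Qed.

Definition leb (O : polydom) : {measure set 'rV[R]_d -> \bar R} :=
  mrestr (@lebesgue_rV R d) (dom_measurable O).

End domain.
Arguments polydom : clear implicits.

(* Classes, modulo equality a.e. in O, of measurable functions; they coerce to
   a representative. *)
Notation mxfield R O m n := (@aeEqMfun _ _ _ _ (matrix R m n) (leb O)).
Notation scfield R O := (@aeEqMfun _ _ R _ R (leb O)).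

Section fields.
Context {R : realType} (d : nat) (O : polydom R d).
Local Notation E := 'rV[R]_d.
Local Notation mu := (leb O).

Definition mxdot m n (A B : 'M[R]_(m, n)) : R :=
  \sum_(i < m) \sum_(j < n) A i j * B i j.

Definition mxnorm m n (A : 'M[R]_(m, n)) : R := Num.sqrt (mxdot A A).

Definition mxpair m n (u w : E -> 'M[R]_(m, n)) : R :=
  \int[mu]_x mxdot (u x) (w x).
Definition scpair (u w : E -> R) : R := \int[mu]_x (u x * w x).

Definition in_L m n (r : R) (u : E -> 'M[R]_(m, n)) : Prop :=
  finite_norm mu r%:E (fun x => mxnorm (u x)).
Definition in_Lsc (r : R) (u : E -> R) : Prop := finite_norm mu r%:E u.

Definition Lnrm m n (r : R) (u : E -> 'M[R]_(m, n)) : R :=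
  fine ('N[mu]_r%:E[EFin \o (fun x => mxnorm (u x))])%E.
Definition Lnrmsc (r : R) (u : E -> R) : R := fine ('N[mu]_r%:E[EFin \o u])%E.

Record L2field := MkL2field {
  l2val :> mxfield R O 1 d ;
  l2P : in_L 2 l2val
}.

HB.instance Definition _ := gen_eqMixin L2field.
HB.instance Definition _ := gen_choiceMixin L2field.

Definition field0 : mxfield R O 1 d := \pi_(mxfield R O 1 d)%qT (cst 0).

Lemma field0P : {ae mu, forall x, field0 x = 0}.
Proof.
have /eqmodP : (repr field0 = cst 0 %[mod mxfield R O 1 d])%qT by rewrite reprK.
by move=> /asboolP; apply: filterS => x; exact.
Qed.

Lemma measurable_mxnorm dT (T : measurableType dT) m n
    (u : T -> 'M[R]_(m, n)) :
  measurable_fun setT u -> measurable_fun setT (fun x => mxnorm (u x)).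
Proof.
move=> mu_; rewrite /mxnorm.
apply: (measurableT_comp (continuous_measurable_fun (@sqrt_continuous R))).
rewrite /mxdot; apply: measurable_sum => i; apply: measurable_sum => j.
by apply: measurable_funM; exact: measurableT_comp (measurable_entry i j) mu_.
Qed.

Lemma in_L2_field0 : in_L 2 field0.
Proof.
have mf : measurable_fun setT field0 by exact: measurable_funPT.
rewrite /in_L /finite_norm unlock.
rewrite (@ge0_ae_eq_integral _ _ _ _ _ _ (cst 0%E))//=.
- by rewrite integral0 poweR0r// invr_neq0.
- apply/measurable_EFinP.
  apply: (measurableT_comp (f := fun y : R => y `^ 2)) => //.
  by apply: measurableT_comp => //; exact: measurable_mxnorm.
- apply: filterS field0P => x -> _ /=.
  rewrite /mxnorm /mxdot big1 ?sqrtr0 ?normr0 ?powR0// => i _.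
  by rewrite big1// => j _; rewrite mxE mulr0.
Qed.

Definition L2zero : L2field := MkL2field in_L2_field0.

HB.instance Definition _ := isPointed.Build L2field L2zero.

Definition L2dist (u w : L2field) : R := Lnrm 2 (fun x => u x - w x).

(* The open sets of the L^2 distance, given directly so that the topology
   does not presuppose the triangle inequality. *)
Definition L2open : set_system L2field :=
  [set U | forall u, U u ->
     exists2 e : R, 0 < e & forall w, L2dist u w < e -> U w].

Lemma L2openT : L2open setT.
Proof. by move=> u _; exists 1. Qed.

Lemma L2openI : setI_closed L2open.
Proof.
move=> A B oA oB u [/oA[a a0 aA] /oB[b b0 bB]].
exists (Num.min a b); first by rewrite lt_min a0 b0.
by move=> w; rewrite lt_min => /andP[/aA ? /bB].
Qed.

Lemma L2open_bigU (I : Type) (f : I -> set L2field) :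
  (forall i, L2open (f i)) -> L2open (\bigcup_i f i).
Proof.
move=> of_ u [i _ /of_[e e0 ef]]; exists e => // w /ef fw.
by exists i.
Qed.

HB.instance Definition _ :=
  isOpenTopological.Build L2field L2openT L2openI L2open_bigU.

Definition L2borel := g_sigma_algebraType (@open L2field).

End fields.

Section sobolev.
Context {R : realType} (d : nat) (O : polydom R d).
Local Notation E := 'rV[R]_d.
Local Notation mu := (leb O).

Definition basis_vec (j : 'I_d) : E := delta_mx 0 j.

Fixpoint Ck_on (D : set E) (k : nat) (f : E -> R^o) : Prop :=
  (forall x, D x -> {for x, continuous f}) /\
  match k with
  | 0 => True
  | l.+1 => forall j, (forall x, D x -> derivable f x (basis_vec j)) /\
                      Ck_on D l ('D_(basis_vec j) f)
  end.

Definition smooth_on (D : set E) (f : E -> R^o) := forall k, Ck_on D k f.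

Definition test_function (phi : E -> R^o) : Prop :=
  smooth_on setT phi /\
  exists2 K : set E, compact K /\ K `<=` dom O & forall x, ~ K x -> phi x = 0.

(* Gradients of vector fields are indexed so that entry (j, i) is the j-th
   partial derivative of the i-th component. *)
Definition grad (f : E -> E) (x : E) : 'M[R]_d :=
  \matrix_(j, i) 'D_(basis_vec j) ((fun y => f y 0 i) : E -> R^o) x.

Definition weak_grad (z : mxfield R O 1 d) (G : mxfield R O d d) : Prop :=
  forall phi, test_function phi -> forall i j,
    \int[mu]_x (z x 0 i * 'D_(basis_vec j) phi x) =
    - \int[mu]_x (G x j i * phi x).

Definition smooth_solenoidal (f : E -> E) : Prop :=
  (forall i, smooth_on (dom O) (fun x => f x 0 i)) /\
  forall x, dom O x -> \tr (grad f x) = 0.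

(* Membership in the closure, for the W^{1,oo} norm, of the smooth divergence
   free vector fields. *)
Definition W1oo_div (s : mxfield R O 1 d) : Prop :=
  exists G : mxfield R O d d,
  [/\ exists M : R, {ae mu, forall x, mxnorm (s x) <= M /\ mxnorm (G x) <= M},
      weak_grad s G &
      forall e : R, 0 < e -> exists2 f : E -> E, smooth_solenoidal f &
        {ae mu, forall x, mxnorm (s x - f x) <= e /\
                          mxnorm (G x - grad f x) <= e}].

End sobolev.

Section gradient_discretisation.
Context {R : realType} (d : nat) (O : polydom R d).
Local Notation E := 'rV[R]_d.
Local Notation mu := (leb O).

Definition conj_exp (p : R) : R := p / (p - 1).

(* Linearity as a map into classes of functions, expressed on the
   representatives. *)
Definition ae_linear (V : lmodType R) (Z : lmodType R) (F : V -> E -> Z) :=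
  forall a u v, {ae mu, forall x, F (a *: u + v) x = a *: F u x + F v x}.

Record GD := MkGD {
  XD : vectType R ;
  YD : vectType R ;
  nablaD : XD -> mxfield R O d d ;
  epsD : XD -> mxfield R O d d ;
  chiD : YD -> scfield R O ;
  divD : XD -> scfield R O ;
  PiD : XD -> L2field O
}.

Definition Y0 (D : GD) : set (YD D) := [set q | \int[mu]_x chiD q x = 0].

Definition E0 (D : GD) : set (XD D) :=
  [set v | forall q : YD D, Y0 q -> scpair O (chiD q) (divD v) = 0].

Record is_GD (p : R) (D : GD) : Prop := IsGD {
  nablaD_lin : ae_linear (fun v => @nablaD D v) ;
  epsD_lin : ae_linear (fun v => @epsD D v) ;
  chiD_lin : ae_linear (fun q => @chiD D q : E -> R^o) ;
  divD_lin : ae_linear (fun v => @divD D v : E -> R^o) ;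
  PiD_lin : ae_linear (fun v => @PiD D v) ;
  nablaD_L : forall v : XD D,
    in_L O p (nablaD v) /\ in_L O (conj_exp p) (nablaD v) ;
  epsD_L : forall v : XD D,
    in_L O p (epsD v) /\ in_L O (conj_exp p) (epsD v) ;
  divD_L : forall v : XD D,
    in_Lsc O p (divD v) /\ in_Lsc O (conj_exp p) (divD v) ;
  PiD_L : forall v : XD D,
    in_L O p (PiD v) /\ in_L O (conj_exp p) (PiD v) ;
  chiD_L : forall q : YD D, in_Lsc O (Num.min p (conj_exp p)) (chiD q) ;
  (* the seminorms given by epsD and chiD are norms on XD and Y0 *)
  epsD_norm : forall v : XD D, Lnrm O p (epsD v) = 0 -> v = 0 ;
  chiD_norm : forall q : YD D, Y0 q ->
    Lnrmsc O (Num.min p (conj_exp p)) (chiD q) = 0 -> q = 0 ;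
  PiD_inj : {in @E0 D &, injective (@PiD D)}
}.

Section constants.
Variables (p : R) (D : GD).

(* The defining relation makes sense, and is used, for z in L^r with r = p, p'
   as well as for z in L^2. *)
Definition KD (z : E -> E) : XD D :=
  xget 0 [set w : XD D | E0 w /\ forall xi : XD D, E0 xi ->
                    mxpair O (fun x => z x - PiD w x) (PiD xi) = 0].

Definition CD (r : R) : \bar R :=
  ereal_sup [set ((Lnrm O r (PiD v) + Lnrmsc O r (divD v) +
                   Lnrm O r (nablaD v)) / Lnrm O r (epsD v))%:E
            | v in [set v : XD D | v != 0]].

Definition CSob (r : R) : \bar R :=
  ereal_sup [set (Lnrm O r (epsD (KD zG.1)) /
                  (Lnrm O r zG.1 + Lnrm O r zG.2))%:E
            | zG in [set zG : mxfield R O 1 d * mxfield R O d d |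
                [/\ in_L O r zG.1, in_L O r zG.2, weak_grad zG.1 zG.2 &
                    ~ {ae mu, forall x, zG.1 x = 0}]]].

Definition betaD : \bar R :=
  ereal_inf [set
    ereal_sup [set
      (scpair O (chiD q) (divD v) /
       (Lnrmsc O (Num.min p (conj_exp p)) (chiD q) *
        (Lnrm O p (epsD v) + Lnrm O (conj_exp p) (epsD v))))%:E
      | v in [set v : XD D | v != 0]]
    | q in [set q : YD D | Y0 q /\ q != 0]].

Definition stableD (Gamma : R) : Prop :=
  [/\ (CD p + CD (conj_exp p) <= Gamma%:E)%E,
      ((Gamma^-1)%:E <= betaD)%E &
      (CSob p + CSob (conj_exp p) <= Gamma%:E)%E].

End constants.
End gradient_discretisation.

Section noise.
Context {R : realType} d (Omega : measurableType d) (P : probability Omega R).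

Definition usual_filtration (F : R -> set_system Omega) : Prop :=
  [/\ forall t, 0 <= t -> sigma_algebra setT (F t) /\ F t `<=` measurable,
      forall s t, 0 <= s -> s <= t -> F s `<=` F t,
      forall N, P.-negligible N -> F 0 N &
      forall t, 0 <= t -> \bigcap_(s in [set s | t < s]) F s `<=` F t].

Definition Wiener (F : R -> set_system Omega) (W : R -> Omega -> R) : Prop :=
  [/\ {ae P, forall w, W 0 w = 0},
      {ae P, forall w, {within `[0, +oo[, continuous (fun t => W t w)}},
      forall t, 0 <= t -> forall B, measurable B -> F t (W t @^-1` B),
      forall s t, 0 <= s -> s < t -> forall B : set R, measurable B ->
        P [set w | B (W t w - W s w)] = normal_prob 0 (Num.sqrt (t - s)) B &
      forall s t, 0 <= s -> s < t -> forall A B, F s A -> measurable B ->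
        P (A `&` [set w | B (W t w - W s w)]) =
        (P A * P [set w | B (W t w - W s w)%R])%E].

(* Measurability for the Borel sigma-algebra of a finite dimensional space,
   tested on linear forms. *)
Definition rvar (V : vectType R) (X : Omega -> V) : Prop :=
  forall l : {linear V -> R^o}, measurable_fun setT (fun w => l (X w) : R).

End noise.

Section scheme.
Context {R : realType} (d : nat) (O : polydom R d) (p : R) (D : GD O).
Context d' (Omega : measurableType d') (P : probability Omega R).

Definition Sop (kappa : R) (A : 'M[R]_d) : 'M[R]_d :=
  ((kappa + mxnorm A ^+ 2) `^ ((p - 2) / 2)) *: A.

(* nablaD v has entry (j, i) standing for the j-th derivative of component i,
   so that sigma^T nablaD v is a row vector times matrix product. *)
Definition Bsigma (s : mxfield R O 1 d) (v xi : XD D) : R :=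
  2^-1 * mxpair O (fun x => s x *m nablaD v x) (PiD xi) -
  2^-1 * mxpair O (PiD v) (fun x => s x *m nablaD xi x).

Definition initialised (vin : L2field O) (v0 : XD D) (pi0 : YD D) : Prop :=
  [/\ Y0 pi0,
      forall xi : XD D,
        mxpair O (PiD v0) (PiD xi) + scpair O (chiD pi0) (divD xi) =
        mxpair O vin (PiD xi) &
      forall q : YD D, Y0 q -> scpair O (divD v0) (chiD q) = 0].

Definition midpoint (v w : XD D) : XD D := 2^-1 *: (w + v).

(* With g = 0 the terms in eps g and (sigma . grad) g vanish. *)
Definition time_step (kappa : R) (s : mxfield R O 1 d) (tau dW : R)
    (v0 v1 : XD D) (pi0 pi1 : YD D) : Prop :=
  (forall xi : XD D,
     mxpair O (fun x => PiD v1 x - PiD v0 x) (PiD xi)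
     + tau * mxpair O (fun x => Sop kappa (epsD (midpoint v0 v1) x)) (epsD xi)
     - scpair O (fun x => chiD pi1 x - chiD pi0 x) (divD xi)
     = Bsigma s (midpoint v0 v1) xi * dW) /\
  (forall q : YD D, Y0 q -> scpair O (divD (midpoint v0 v1)) (chiD q) = 0).

Definition algorithm (kappa : R) (s : mxfield R O 1 d) (tau : R)
    (W : R -> Omega -> R) (vin : L2field O)
    (v : nat -> Omega -> XD D) (pi : nat -> Omega -> YD D) : Prop :=
  [/\ forall n, rvar (v n) /\ rvar (pi n),
      forall n w, Y0 (pi n w),
      forall w, initialised vin (v 0%N w) (pi 0%N w) &
      forall n, {ae P, forall w,
        time_step kappa s tau (W (n.+1%:R * tau) w - W (n%:R * tau) w)
          (v n w) (v n.+1 w) (pi n w) (pi n.+1 w)}].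

Definition Cb (f : L2field O -> R) : Prop :=
  continuous f /\ exists M, forall u, `|f u| <= M.

Definition transition_semigroup (S : L2field O -> nat -> Omega -> XD D) (n : nat)
    (f : L2field O -> R) (vin : L2field O) : R :=
  fine 'E_P[fun w => f (PiD (S vin n w))]%E.

Definition invariant_measure (S : L2field O -> nat -> Omega -> XD D)
    (m : probability (L2borel O) R) : Prop :=
  forall n f, (0 < n)%N -> Cb f ->
    (\int[m]_u (transition_semigroup S n f u)%:E = \int[m]_u (f u)%:E)%E.

(* The average of the laws of X 0, ..., X N.-1; the junk value at N = 0 is
   irrelevant to limits in N. *)
Definition mean_law (X : nat -> Omega -> L2field O) (N : nat) :
    set (L2borel O) -> \bar R :=
  fun A => ((N%:R^-1)%:E * \sum_(n < N) P [set w | A (X n w)])%E.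

Definition weak_cvg (m_ : nat -> set (L2borel O) -> \bar R)
    (m : set (L2borel O) -> \bar R) : Prop :=
  forall f, Cb f ->
    (\int[m_ N]_u (f u)%:E)%E @[N --> \oo] --> (\int[m]_u (f u)%:E)%E.

End scheme.

(* Main.v *)
Require Import Defs.
From HB Require Import structures.
From mathcomp Require Import all_boot all_order all_algebra.
From mathcomp Require Import all_classical all_reals all_analysis.
From mathcomp Require Import measurable_realfun.
From mathcomp Require Import ring lra.

Set Implicit Arguments.
Unset Strict Implicit.
Unset Printing Implicit Defensive.
Import Order.TTheory GRing.Theory Num.Theory.
Import VectorInternalTheory.
Import numFieldNormedType.Exports.

Local Open Scope classical_set_scope.
Local Open Scope ring_scope.

(** The velocity is killed by the dissipation, and the noise cannot prevent it
because the noise form is antisymmetric.  Testing the scheme with the midpoint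
velocity m_n = (v_n + v_(n+1)) / 2 makes the noise and the pressure drop out and
gives the pathwise balance ([step_energy])

  |Pi v_(n+1)|^2 + 2 tau int (kappa + |eps m_n|^2)^((p-2)/2) |eps m_n|^2
    = |Pi v_n|^2.

Hence |Pi v_n| is nonincreasing and the dissipation of m_n tends to 0.  A small
dissipation forces small coordinates ([energy_coercive]): it controls a weighted
L1 norm of the strain, and all norms on a finite-dimensional space are
equivalent ([seminorm_coercive]).  So m_n tends to 0 on every path that satisfies
the scheme ([PiD_nrm_midpoint_cvg]).

This does not yet give v_n -> 0, since v_(n+1) could be close to - v_n.  Testing
with the increment v_(n+1) - v_n, which stays bounded by the energy balance, gives

  |Pi (v_(n+1) - v_n)|^2 = - tau (S (eps m_n), eps (v_(n+1) - v_n))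
                           + B (m_n, v_(n+1) - v_n) (W_(n+1) - W_n),

and the right-hand side is small as soon as n is large and the Wiener increment
is not.  Almost surely some bound on the increments is met infinitely often:
as they are identically distributed, the probability that |W_(n+1) - W_n| > K for
all large n is at most the probability that the first increment exceeds K
([identically_distributed_recurrent]).  So |Pi v_n| is arbitrarily small along a
subsequence, hence tends to 0 because it is monotone ([trajectory_cvg]).

The averaged laws converge by dominated convergence and Cesaro's lemma
([mean_law_weak_cvg]).  For the invariant measure, apply invariance to the bounded
continuous function f (u) = min (1, |u|).  The functions P^n f tend to 0
pointwise, and all have the same integral as f, so f vanishes almost everywhere
([invariant_dirac]).  Here the integral of P^n f, as a function of the initial
datum, is the supremum of the integrals of the simple functions below it, and
dominated convergence is applied to these ([lower_integral_cvg0]).  Conversely, an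
integral against a Dirac mass at a measurable point only sees the value there
([eq_integral_dirac]), and zero initial data stay zero ([algorithm_zero]). *)

(** * Power-law stress *)

Section stress.
Context {R : realType} (p kappa : R).
Hypotheses (hp : 1 < p) (hkappa : 0 <= kappa).

Definition viscosity (s : R) : R := (kappa + s ^+ 2) `^ ((p - 2) / 2).

(** The exponent in the homogeneity bound [viscosity_scale]: 1 for p >= 2, where
    the viscosity increases with the strain, and p - 1 for p <= 2. *)
Definition growth_exp : R := Num.min 1 (p - 1).

Lemma viscosity_ge0 s : 0 <= viscosity s.
Proof. exact: powR_ge0. Qed.

Lemma viscosity_gt0 s : 0 < s -> 0 < viscosity s.
Proof. by move=> s0; rewrite powR_gt0// ltr_wpDl// exprn_gt0. Qed.

Lemma growth_exp_gt0 : 0 < growth_exp.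
Proof. by rewrite /growth_exp lt_min ltr01 subr_gt0. Qed.

(** For p >= 2 the viscosity is nondecreasing; for p < 2 compare
    kappa + l^2 t^2 >= l^2 (kappa + t^2) and raise to a negative power. *)
Lemma viscosity_scale l t : 0 < l -> l <= 1 -> 0 <= t ->
  viscosity (l * t) * (l * t) <= l `^ growth_exp * (viscosity t * t).
Proof.
move=> l0 l1; rewrite le_eqVlt => /predU1P[<-|t0]; first by rewrite !mulr0.
rewrite 2!mulrA ler_pM2r//.
have kt : 0 < kappa + t ^+ 2 by rewrite ltr_wpDl// exprn_gt0.
have l20 : 0 < l ^+ 2 by rewrite exprn_gt0.
have l21 : l ^+ 2 <= 1 by rewrite exprn_ile1// ltW.
have klt : 0 < kappa + (l * t) ^+ 2 by rewrite ltr_wpDl// exprn_gt0// mulr_gt0.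
have [p2|p2] := leP 2 p.
  have -> : growth_exp = 1 by rewrite /growth_exp min_l//; lra.
  rewrite (powRr1 (ltW l0)) mulrC ler_pM2l// ge0_ler_powR ?nnegrE ?(ltW klt) ?(ltW kt)//.
    by rewrite divr_ge0// subr_ge0.
  by rewrite exprMn lerD2l ler_piMl// sqr_ge0.
have -> : growth_exp = p - 1 by rewrite /growth_exp min_r//; lra.
have -> : p - 1 = (p - 2) + 1 by lra.
rewrite powRD; last by apply/implyP => _; rewrite gt_eqF.
rewrite (powRr1 (ltW l0)) mulrAC ler_pM2r//.
have -> : l `^ (p - 2) = (l ^+ 2) `^ ((p - 2) / 2).
  rewrite -(powR_mulrn _ (ltW l0)) -powRrM; congr powR; lra.
rewrite /viscosity -(powRM _ (ltW l20) (ltW kt)).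
have -> : (p - 2) / 2 = - ((2 - p) / 2) by lra.
rewrite !(powRN _ ((2 - p) / 2)) lef_pV2 ?posrE ?powR_gt0 ?mulr_gt0//.
rewrite ge0_ler_powR ?nnegrE ?(ltW klt) ?(ltW (mulr_gt0 l20 kt))//.
  by rewrite divr_ge0// subr_ge0 ltW.
by rewrite exprMn mulrDr lerD2r ler_piMl.
Qed.

(** The scaling bound with l = s / t, whose growth factor is at most 1. *)
Lemma stress_le s t : 0 <= s -> s <= t -> viscosity s * s <= viscosity t * t.
Proof.
move=> s0 st; have [t0|] := ltP 0 t; last first.
  move=> t0; have -> : s = t by apply/le_anti; rewrite st (le_trans t0).
  exact: lexx.
move: s0; rewrite le_eqVlt => /predU1P[<-|s0].
  by rewrite mulr0 (mulr_ge0 (viscosity_ge0 _) (ltW t0)).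
have l0 : 0 < s / t by rewrite divr_gt0.
have l1 : s / t <= 1 by rewrite ler_pdivrMr// mul1r.
have := viscosity_scale l0 l1 (ltW t0); rewrite divfK ?gt_eqF// => /le_trans; apply.
rewrite ler_piMl// ?(mulr_ge0 (viscosity_ge0 _) (ltW t0))//.
rewrite -[leRHS](powRr0 (s / t)) ger_powR ?l0//; exact: ltW growth_exp_gt0.
Qed.

Lemma energy_le s t : 0 <= s -> s <= t -> viscosity s * s ^+ 2 <= viscosity t * t ^+ 2.
Proof.
move=> s0 st; rewrite !expr2 !mulrA ler_pM// ?stress_le//.
by rewrite mulr_ge0// viscosity_ge0.
Qed.

(** Makes the dissipation integrable: the strains are in L^p and in L^p',
    hence in L^2 as well. *)
Lemma energy_growth : exists2 C, 0 <= C &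
  forall s, 0 <= s -> viscosity s * s ^+ 2 <= C * (s ^+ 2 + s `^ p).
Proof.
have spE s : 0 < s -> (s ^+ 2) `^ ((p - 2) / 2) * s ^+ 2 = s `^ p.
  move=> s0; rewrite -(powR_mulrn _ (ltW s0)) -powRrM.
  rewrite -powRD; last by apply/implyP => _; rewrite gt_eqF.
  congr powR; lra.
have p0 : p != 0 by rewrite gt_eqF// (lt_trans ltr01).
have [p2|p2] := leP 2 p; last first.
  exists 1 => // s; rewrite le_eqVlt => /predU1P[<-|s0].
    by rewrite expr0n mulr0 add0r powR0// mulr0.
  rewrite mul1r -spE// -[leLHS]add0r lerD ?sqr_ge0// ler_pM2r ?exprn_gt0//.
  rewrite /viscosity.
  have -> : (p - 2) / 2 = - ((2 - p) / 2) by lra.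
  have s20 : 0 < s ^+ 2 by rewrite exprn_gt0.
  have ks : 0 < kappa + s ^+ 2 by rewrite ltr_wpDl.
  rewrite !(powRN _ ((2 - p) / 2)) lef_pV2 ?posrE ?powR_gt0//.
  rewrite ge0_ler_powR ?nnegrE ?(ltW s20) ?(ltW ks) ?lerDr//.
  by rewrite divr_ge0// subr_ge0 ltW.
have g0 : 0 <= (p - 2) / 2 by rewrite divr_ge0// subr_ge0.
exists ((2 * kappa) `^ ((p - 2) / 2) + 2 `^ ((p - 2) / 2)).
  by rewrite addr_ge0 ?powR_ge0.
move=> s; rewrite le_eqVlt => /predU1P[<-|s0].
  by rewrite expr0n mulr0 add0r powR0// mulr0.
have s20 := sqr_ge0 s.
apply: (@le_trans _ _ ((2 * kappa) `^ ((p - 2) / 2) * s ^+ 2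
    + 2 `^ ((p - 2) / 2) * s `^ p)).
  rewrite -(spE s s0) mulrA -mulrDl ler_pM2r ?exprn_gt0// -powRM//.
  have [ks|ks] := leP kappa (s ^+ 2).
    apply: (@le_trans _ _ ((2 * s ^+ 2) `^ ((p - 2) / 2))).
      rewrite ge0_ler_powR ?nnegrE ?addr_ge0 ?mulr_ge0//; lra.
    by rewrite lerDr powR_ge0.
  apply: (@le_trans _ _ ((2 * kappa) `^ ((p - 2) / 2))).
    rewrite ge0_ler_powR ?nnegrE ?addr_ge0 ?mulr_ge0//; lra.
  by rewrite lerDl powR_ge0.
have h1 : 0 <= (2 * kappa) `^ ((p - 2) / 2) * s `^ p by rewrite mulr_ge0 ?powR_ge0.
have h2 : 0 <= 2 `^ ((p - 2) / 2) * s ^+ 2 by rewrite mulr_ge0 ?powR_ge0.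
rewrite [leRHS]mulrDl [X in _ <= X + _]mulrDr [X in _ <= _ + X]mulrDr; lra.
Qed.

(** Either t <= s / l, and the first term suffices, or s < l t, and monotonicity
    of the stress together with its scaling gives the second one.  The factor
    l `^ growth_exp makes the contribution of a bounded test function small. *)
Lemma stress_young l s t : 0 < l -> l <= 1 -> 0 <= s -> 0 <= t ->
  viscosity s * s * t <= l^-1 * (viscosity s * s ^+ 2) + l `^ growth_exp * (viscosity t
    * t ^+ 2).
Proof.
move=> l0 l1 s0 t0.
have e0 u : 0 <= viscosity u * u ^+ 2 by rewrite mulr_ge0 ?viscosity_ge0 ?sqr_ge0.
have [lts|slt] := leP (l * t) s.
  rewrite -[leLHS]addr0 lerD ?mulr_ge0 ?powR_ge0 ?viscosity_ge0 ?sqr_ge0//.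
  rewrite (expr2 s) [viscosity s * (s * s)]mulrA [leRHS]mulrC -[leRHS]mulrA.
  rewrite ler_wpM2l ?mulr_ge0 ?viscosity_ge0//.
  by rewrite ler_pdivlMr// mulrC.
rewrite -[leLHS]add0r lerD ?(mulr_ge0 _ (e0 s)) ?invr_ge0 ?(ltW l0)//.
rewrite (expr2 t) [viscosity t * (t * t)]mulrA [leRHS]mulrA ler_wpM2r//.
apply: le_trans (viscosity_scale l0 l1 t0).
by apply: stress_le => //; exact: ltW.
Qed.

(** The energy density grows at least linearly away from 0, with a slope given by
    the monotone stress at e. *)
Lemma le_stress_energy e s : 0 < e -> 0 <= s ->
  s <= e + (viscosity e * e)^-1 * (viscosity s * s ^+ 2).
Proof.
move=> e0 s0; have d0 : 0 < viscosity e * e by rewrite mulr_gt0// viscosity_gt0.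
have [se|es] := leP s e.
  by rewrite -[leLHS]addr0 lerD// mulr_ge0 ?invr_ge0 ?(ltW d0) ?mulr_ge0 ?viscosity_ge0
    ?sqr_ge0.
rewrite -[leLHS]add0r lerD ?(ltW e0)// [leRHS]mulrC ler_pdivlMr//.
rewrite (expr2 s) [leRHS]mulrA [leLHS]mulrC ler_wpM2r// stress_le ?(ltW e0) ?(ltW es)//.
Qed.

End stress.

(** * Frobenius product *)

Section frobenius.
Context {R : realType} {m n : nat}.
Implicit Types A B C : 'M[R]_(m, n).

(** Nonpositive discriminant; the common source of the Cauchy-Schwarz inequalities
    for matrices and for square-integrable fields. *)
Lemma quad_discr (a b c : R) : 0 <= a -> 0 <= c ->
  (forall t, 0 <= a + 2 * b * t + c * t ^+ 2) -> `|b| <= Num.sqrt a * Num.sqrt c.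
Proof.
move=> a0 c0 h.
rewrite -sqrtrM// -(sqrtr_sqr b) ler_wsqrtr//.
move: c0; rewrite le_eqVlt => /predU1P[c0|c0].
  rewrite -c0 mulr0; have [->|b0] := eqVneq b 0; first by rewrite expr0n.
  have := h (- (a + 1) / (2 * b)); rewrite -c0 mul0r addr0.
  have -> : 2 * b * (- (a + 1) / (2 * b)) = - (a + 1) by field.
  lra.
have := h (- b / c).
have -> : a + 2 * b * (- b / c) + c * (- b / c) ^+ 2 = (a * c - b ^+ 2) / c.
  by field; rewrite gt_eqF.
by rewrite pmulr_lge0 ?invr_gt0// subr_ge0.
Qed.

Lemma mxdotC A B : mxdot A B = mxdot B A.
Proof. by apply: eq_bigr => i _; apply: eq_bigr => j _; rewrite mulrC. Qed.

Lemma mxdot_linl a A B C : mxdot (a *: A + B) C = a * mxdot A C + mxdot B C.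
Proof.
rewrite /mxdot mulr_sumr -big_split; apply: eq_bigr => i _ /=.
rewrite mulr_sumr -big_split; apply: eq_bigr => j _ /=.
by rewrite !mxE mulrDl mulrA.
Qed.

Lemma mxdotDl A B C : mxdot (A + B) C = mxdot A C + mxdot B C.
Proof. by rewrite -[A]scale1r mxdot_linl mul1r scale1r. Qed.

Lemma mxdot0l A : mxdot 0 A = 0.
Proof.
by rewrite /mxdot big1// => i _; rewrite big1// => j _; rewrite mxE mul0r.
Qed.

Lemma mxdotZl a A B : mxdot (a *: A) B = a * mxdot A B.
Proof. by have := mxdot_linl a A 0 B; rewrite mxdot0l !addr0. Qed.

Lemma mxdot_ge0 A : 0 <= mxdot A A.
Proof.
by apply: sumr_ge0 => i _; apply: sumr_ge0 => j _; rewrite -expr2 sqr_ge0.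
Qed.

Lemma mxnorm_ge0 A : 0 <= mxnorm A.
Proof. exact: sqrtr_ge0. Qed.

Lemma mxnorm_sqr A : mxnorm A ^+ 2 = mxdot A A.
Proof. by rewrite sqr_sqrtr// mxdot_ge0. Qed.

Lemma mxnorm_eq0 A : mxnorm A = 0 -> A = 0.
Proof.
move=> A0; have : mxdot A A = 0 by rewrite -mxnorm_sqr A0 expr0n.
move=> /psumr_eq0P H; apply/matrixP => i j; rewrite mxE.
have /H/(_ i isT)/psumr_eq0P K : forall i : 'I_m, true ->
    0 <= \sum_(j < n) A i j * A i j.
  by move=> k _; apply: sumr_ge0 => l _; rewrite -expr2 sqr_ge0.
have /eqP : A i j * A i j = 0 by apply: K => // l _; rewrite -expr2 sqr_ge0.
by rewrite mulf_eq0 => /orP[] /eqP.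
Qed.

Lemma mxdot_cs A B : `|mxdot A B| <= mxnorm A * mxnorm B.
Proof.
apply: quad_discr; rewrite ?mxdot_ge0// => t; have := mxdot_ge0 (t *: B + A).
rewrite mxdot_linl (mxdotC B (_ + _)) (mxdotC A (_ + _)) !mxdot_linl (mxdotC B A) expr2.
by congr (_ <= _); ring.
Qed.

Lemma mxnormZ a A : mxnorm (a *: A) = `|a| * mxnorm A.
Proof.
by rewrite /mxnorm mxdotZl mxdotC mxdotZl mulrA -expr2 sqrtrM ?sqr_ge0// sqrtr_sqr.
Qed.

Lemma mxnormD A B : mxnorm (A + B) <= mxnorm A + mxnorm B.
Proof.
rewrite -(@ler_pXn2r _ 2)// ?nnegrE ?addr_ge0 ?mxnorm_ge0//.
rewrite mxnorm_sqr mxdotDl (mxdotC A (_ + _)) (mxdotC B (_ + _)) !mxdotDl sqrrD.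
rewrite -!mxnorm_sqr (mxdotC B A) addrA.
have := mxdot_cs A B; have := ler_norm (mxdot A B); rewrite mulr2n; lra.
Qed.

Lemma mxnorm0 : mxnorm (0 : 'M[R]_(m, n)) = 0.
Proof. by rewrite /mxnorm mxdot0l sqrtr0. Qed.

End frobenius.

Lemma mxnorm_mul (R : realType) m n (s : 'rV[R]_m) (A : 'M[R]_(m, n)) :
  mxnorm (s *m A) <= mxnorm s * mxnorm A.
Proof.
rewrite -(@ler_pXn2r _ 2)// ?nnegrE ?mulr_ge0 ?mxnorm_ge0//.
rewrite exprMn !mxnorm_sqr {1}/mxdot big_ord1.
rewrite [X in _ <= _ * X](_ : mxdot A A = \sum_j mxdot (col j A)^T (col j A)^T).
  rewrite mulr_sumr; apply: ler_sum => j _; rewrite -expr2.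
  have -> : (s *m A) 0 j = mxdot s (col j A)^T.
    by rewrite /mxdot big_ord1 mxE; apply: eq_bigr => k _; rewrite !mxE.
  by rewrite -!mxnorm_sqr -exprMn -real_normK ?num_real// lerXn2r ?nnegrE
     ?mulr_ge0 ?mxnorm_ge0// mxdot_cs.
rewrite {1}/mxdot exchange_big/=; apply: eq_bigr => j _.
by rewrite /mxdot big_ord1; apply: eq_bigr => i _; rewrite !mxE.
Qed.

(** * Measurability of matrix-valued functions *)

Section measurable_matrix_fun.
Context {R : realType} {dT : measure_display} {T : measurableType dT}.

Lemma measurable_mxentry m n (u : T -> 'M[R]_(m, n)) i j :
  measurable_fun setT u -> measurable_fun setT (fun x => u x i j).
Proof. exact: measurableT_comp (measurable_entry i j). Qed.

Lemma measurable_mxdot m n (u w : T -> 'M[R]_(m, n)) :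
  measurable_fun setT u -> measurable_fun setT w ->
  measurable_fun setT (fun x => mxdot (u x) (w x)).
Proof.
move=> mu mw; apply: measurable_sum => i; apply: measurable_sum => j.
by apply: measurable_funM; exact: measurable_mxentry.
Qed.

Lemma measurable_mxlin m n a (u w : T -> 'M[R]_(m, n)) :
  measurable_fun setT u -> measurable_fun setT w ->
  measurable_fun setT (fun x => a *: u x + w x).
Proof.
move=> mu mw; apply: measurable_fun_mxP => i j.
under eq_fun do rewrite 2!mxE.
apply: measurable_funD; last exact: measurable_mxentry.
by apply: measurable_funM => //; exact: measurable_mxentry.
Qed.

Lemma measurable_mxB m n (u w : T -> 'M[R]_(m, n)) :
  measurable_fun setT u -> measurable_fun setT w ->
  measurable_fun setT (fun x => u x - w x).
Proof.
move=> mu mw; apply: measurable_fun_mxP => i j.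
under eq_fun do rewrite 2!mxE.
by apply: measurable_funB; exact: measurable_mxentry.
Qed.

Lemma measurable_mxmul m n k (u : T -> 'M[R]_(m, n)) (w : T -> 'M[R]_(n, k)) :
  measurable_fun setT u -> measurable_fun setT w ->
  measurable_fun setT (fun x => u x *m w x).
Proof.
move=> mu mw; apply: measurable_fun_mxP => i j.
under eq_fun do rewrite mxE.
by apply: measurable_sum => l; apply: measurable_funM; exact: measurable_mxentry.
Qed.

Lemma measurable_Sop d p kappa (u : T -> 'M[R]_d) :
  measurable_fun setT u -> measurable_fun setT (fun x => Sop p kappa (u x)).
Proof.
move=> mu; apply: measurable_fun_mxP => i j.
under eq_fun do rewrite mxE.
apply: measurable_funM; last exact: measurable_mxentry.
apply: (measurableT_comp (measurable_powR _)).
apply: measurable_funD => //; apply: measurable_funX.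
exact: measurable_mxnorm.
Qed.

End measurable_matrix_fun.

(** * Real integrals and almost everywhere relations *)

Section Rintegral_ae.
Context {R : realType} {dT : measure_display} {T : measurableType dT}.
Variable mu : {measure set T -> \bar R}.
Implicit Types f g : T -> R.

Definition rintegrable f := mu.-integrable setT (EFin \o f).

Lemma rintegrable_measurable f : rintegrable f -> measurable_fun setT f.
Proof. by move=> /measurable_int/measurable_EFinP. Qed.

Lemma le_rintegrable f g : measurable_fun setT f -> rintegrable g ->
  {ae mu, forall x, `|f x| <= g x} -> rintegrable f.
Proof.
move=> mf ig fg; apply/integrableP; split; first exact/measurable_EFinP.
have /integrableP[mg] := ig; apply: le_lt_trans.
apply: ae_ge0_le_integral => //.
- by do 2 apply: measurableT_comp => //.
- exact: measurableT_comp.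
- apply: filterS fg => x /= fg _; rewrite lee_fin (le_trans fg)// ler_norm//.
Qed.

Lemma rintegrable_ae f g : measurable_fun setT f -> rintegrable g ->
  {ae mu, forall x, f x = g x} -> rintegrable f.
Proof.
move=> mf ig fg; apply: (@le_rintegrable f (fun x => `|g x|)) => //.
  have := integrable_norm ig; exact.
by apply: filterS fg => x /= ->.
Qed.

Lemma rintegrableD f g : rintegrable f -> rintegrable g ->
  rintegrable (fun x => f x + g x).
Proof.
move=> If Ig; have := integrableD measurableT If Ig.
by apply: eq_integrable => // x _.
Qed.

Lemma rintegrableZ a f : rintegrable f -> rintegrable (fun x => a * f x).
Proof.
move=> If; have := integrableZl measurableT a If.
by apply: eq_integrable => // x _.
Qed.

Lemma rintegrable_sum (I : Type) (s : seq I) (F : I -> T -> R) :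
  (forall i, rintegrable (F i)) -> rintegrable (fun x => \sum_(i <- s) F i x).
Proof.
move=> IF; elim: s => [|i s ih].
  under [X in rintegrable X]eq_fun do rewrite big_nil; exact: integrable0.
under [X in rintegrable X]eq_fun do rewrite big_cons; exact: rintegrableD.
Qed.

Lemma Rintegral_ae f g : measurable_fun setT f -> measurable_fun setT g ->
  {ae mu, forall x, f x = g x} -> \int[mu]_x f x = \int[mu]_x g x.
Proof.
move=> mf mg fg; congr fine; apply: ae_eq_integral => //.
- exact/measurable_EFinP.
- exact/measurable_EFinP.
- by apply: filterS fg => x /= -> _.
Qed.

(** Replacing g by max (f, g), equal to g almost everywhere, turns the inequality
    into one that holds everywhere. *)
Lemma ae_le_Rintegral f g : rintegrable f -> rintegrable g ->
  {ae mu, forall x, f x <= g x} -> \int[mu]_x f x <= \int[mu]_x g x.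
Proof.
move=> If Ig fg.
have mf := rintegrable_measurable If; have mg := rintegrable_measurable Ig.
(* max (f, g) is integrable, being bounded by |f| + |g|. *)
have Im : rintegrable (fun x => Num.max (f x) (g x)).
  have [nf ng] := (integrable_norm If, integrable_norm Ig).
  apply: le_rintegrable (rintegrableD nf ng) _; first exact: measurable_maxr.
  apply: aeW => x /=; rewrite /Num.max; case: ifP => _; rewrite ?lerDr ?lerDl//.
rewrite (Rintegral_ae mg (rintegrable_measurable Im)); last first.
  by apply: filterS fg => x fg; rewrite max_r.
apply: le_Rintegral => // x _; rewrite le_max lexx//.
Qed.

Lemma Rintegral_eq0 f : rintegrable f -> (forall x, 0 <= f x) -> \int[mu]_x f x = 0 ->
  {ae mu, forall x, f x = 0}.
Proof.
move=> If f0 If0.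
have : (\int[mu]_x `|(EFin \o f) x| = 0)%E.
  rewrite -[RHS]/((0:R)%:E) -If0 fineK; last exact: integrable_fin_num.
  by apply: eq_integral => x _ /=; rewrite ger0_norm.
have mf := rintegrable_measurable If.
have mEf : measurable_fun setT (EFin \o f) by exact/measurable_EFinP.
move=> /(ae_eq_integral_abs mu measurableT mEf); apply: filterS => x /=.
by move=> /(_ I) [].
Qed.

End Rintegral_ae.

(** * Lebesgue spaces and the L2 pairing of fields *)

Section pairings.
Context {R : realType} (d : nat) (O : polydom R d).
Local Notation E := 'rV[R]_d.
Local Notation mu := (leb O).

Lemma measurable_mxfield m n (u : mxfield R O m n) : measurable_fun setT u.
Proof. exact: measurable_funPT. Qed.

Lemma measurable_scfield (f : scfield R O) : measurable_fun setT f.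
Proof. exact: measurable_funPT. Qed.

Lemma in_Lsc_rintegrable r (f : E -> R) : 1 <= r -> measurable_fun setT f ->
  in_Lsc O r f -> rintegrable mu (fun x => `|f x| `^ r).
Proof.
move=> r1 mf Lf; apply: Lfun_integrable => //.
by rewrite inE; apply/andP; split; rewrite inE.
Qed.

Lemma in_L_rintegrable m n r (u : E -> 'M[R]_(m, n)) : 1 <= r ->
  measurable_fun setT u -> in_L O r u -> rintegrable mu (fun x => mxnorm (u x) `^ r).
Proof.
move=> r1 mu_ Lu; have := in_Lsc_rintegrable r1 (measurable_mxnorm mu_) Lu.
by under eq_fun do rewrite ger0_norm ?mxnorm_ge0//.
Qed.

Lemma rintegrable_young (f g : E -> R) p q : 0 < p -> 0 < q -> p^-1 + q^-1 = 1 ->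
  measurable_fun setT f -> measurable_fun setT g ->
  rintegrable mu (fun x => `|f x| `^ p) -> rintegrable mu (fun x => `|g x| `^ q) ->
  rintegrable mu (fun x => f x * g x).
Proof.
move=> p0 q0 pq mf mg If Ig.
apply: (le_rintegrable _ (rintegrableD (rintegrableZ p^-1 If) (rintegrableZ q^-1 Ig))).
  exact: measurable_funM.
apply: aeW => x /=; rewrite normrM.
by rewrite mulrC [_^-1 * _]mulrC [_^-1 * _]mulrC [`|_| * _]mulrC conjugate_powR.
Qed.

Lemma mxpairC m n (u w : E -> 'M[R]_(m, n)) : mxpair O u w = mxpair O w u.
Proof. by apply: eq_Rintegral => x _; rewrite mxdotC. Qed.

Lemma mxpair_linl m n a (u1 u2 u w : E -> 'M[R]_(m, n)) :
  measurable_fun setT u -> measurable_fun setT w ->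
  {ae mu, forall x, u x = a *: u1 x + u2 x} ->
  rintegrable mu (fun x => mxdot (u1 x) (w x)) ->
    rintegrable mu (fun x => mxdot (u2 x) (w x)) ->
  mxpair O u w = a * mxpair O u1 w + mxpair O u2 w.
Proof.
move=> mu_ mw uE I1 I2; rewrite /mxpair.
have Ia := rintegrableZ a I1.
rewrite -RintegralZl// -RintegralD//.
apply: Rintegral_ae.
- exact: measurable_mxdot.
- exact: rintegrable_measurable (rintegrableD Ia I2).
- by apply: filterS uE => x ->; rewrite mxdot_linl.
Qed.

Lemma mxpair_linr m n a (u1 u2 u w : E -> 'M[R]_(m, n)) :
  measurable_fun setT u -> measurable_fun setT w ->
  {ae mu, forall x, u x = a *: u1 x + u2 x} ->
  rintegrable mu (fun x => mxdot (w x) (u1 x)) ->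
    rintegrable mu (fun x => mxdot (w x) (u2 x)) ->
  mxpair O w u = a * mxpair O w u1 + mxpair O w u2.
Proof.
move=> mu_ mw uE I1 I2; rewrite !(mxpairC w); apply: mxpair_linl => //.
- by move: I1; under eq_fun do rewrite mxdotC.
- by move: I2; under eq_fun do rewrite mxdotC.
Qed.

Lemma mxpairB m n (u1 u2 w : E -> 'M[R]_(m, n)) :
  measurable_fun setT u1 -> measurable_fun setT u2 -> measurable_fun setT w ->
  rintegrable mu (fun x => mxdot (u1 x) (w x)) ->
    rintegrable mu (fun x => mxdot (u2 x) (w x)) ->
  mxpair O (fun x => u1 x - u2 x) w = mxpair O u1 w - mxpair O u2 w.
Proof.
move=> m1 m2 mw I1 I2.
rewrite (@mxpair_linl _ _ (-1) u2 u1 _ w) ?mulN1r ?(addrC (- _))//.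
- exact: measurable_mxB.
- by apply: aeW => x; rewrite scaleN1r addrC.
Qed.

Lemma mxpair_ge0 m n (u : E -> 'M[R]_(m, n)) : 0 <= mxpair O u u.
Proof. by apply: Rintegral_ge0 => x _; exact: mxdot_ge0. Qed.

Lemma mxpair_eq0 m n (u : E -> 'M[R]_(m, n)) :
  rintegrable mu (fun x => mxdot (u x) (u x)) -> mxpair O u u = 0 ->
  {ae mu, forall x, u x = 0}.
Proof.
move=> I /(Rintegral_eq0 I (fun x => mxdot_ge0 (u x))).
by apply: filterS => x /= uu; apply: mxnorm_eq0; rewrite /mxnorm uu sqrtr0.
Qed.

Lemma ae_mxpair_eq0 m n (u w : E -> 'M[R]_(m, n)) :
  measurable_fun setT u -> measurable_fun setT w ->
  {ae mu, forall x, u x = 0} -> mxpair O u w = 0.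
Proof.
move=> mu_ mw u0; rewrite /mxpair (@Rintegral_ae _ _ _ _ _ (cst 0)) ?Rintegral_cst
  ?mul0r//.
  exact: measurable_mxdot.
by apply: filterS u0 => x ->; rewrite mxdot0l.
Qed.

Definition square_integrable m n (u : E -> 'M[R]_(m, n)) :=
  measurable_fun setT u /\ rintegrable mu (fun x => mxdot (u x) (u x)).

Lemma square_integrable_mxdot m n (u w : E -> 'M[R]_(m, n)) : square_integrable u ->
  square_integrable w ->
  rintegrable mu (fun x => mxdot (u x) (w x)).
Proof.
move=> [mu_ Iu] [mw Iw]; apply: le_rintegrable (rintegrableD Iu Iw) _;
  first exact: measurable_mxdot.
apply: aeW => x /=; apply: le_trans (mxdot_cs _ _) _; rewrite -!mxnorm_sqr.
have := mxnorm_ge0 (u x); have := mxnorm_ge0 (w x); nra.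
Qed.

Lemma square_integrable_lin m n a (u w : E -> 'M[R]_(m, n)) : square_integrable u ->
  square_integrable w ->
  square_integrable (fun x => a *: u x + w x).
Proof.
move=> su sw; have [[mu_ Iu] [mw Iw]] := (su, sw).
have ml := measurable_mxlin a mu_ mw; split => //.
have I := rintegrableD (rintegrableZ (a ^+ 2) Iu) (rintegrableD (rintegrableZ (2 * a)
  (square_integrable_mxdot su sw)) Iw).
apply: (rintegrable_ae _ I); first exact: measurable_mxdot.
apply: aeW => x; rewrite mxdot_linl (mxdotC (u x) (_ + _)) (mxdotC (w x) (_ + _)).
by rewrite !mxdot_linl (mxdotC (w x)); ring.
Qed.

Lemma mxpair_cs m n (u w : E -> 'M[R]_(m, n)) : square_integrable u ->
  square_integrable w ->
  `|mxpair O u w| <= Num.sqrt (mxpair O u u) * Num.sqrt (mxpair O w w).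
Proof.
move=> su sw; apply: quad_discr; rewrite ?mxpair_ge0// => t.
have stu := square_integrable_lin t sw su.
have := mxpair_ge0 (fun x => t *: w x + u x).
rewrite (@mxpair_linl _ _ t w u _ _ stu.1 stu.1 (aeW _ _) )//;
  try exact: square_integrable_mxdot.
rewrite 2?(@mxpair_linr _ _ t w u _ _ stu.1 _ (aeW _ _))//;
  try exact: square_integrable_mxdot.
all: try exact: su.1; try exact: sw.1.
by rewrite (mxpairC w u); congr (_ <= _); ring.
Qed.

Lemma square_integrable_L2 (u : L2field O) : square_integrable u.
Proof.
have mf := measurable_mxfield u; split => //.
have I := in_L_rintegrable (ler1n _ 2) mf (l2P u).
apply: (rintegrable_ae _ I); first exact: measurable_mxdot.
by apply: aeW => x; rewrite -mxnorm_sqr powR_mulrn ?mxnorm_ge0.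
Qed.

Lemma Lnrm2E m n (u : E -> 'M[R]_(m, n)) : square_integrable u ->
  Lnrm O 2 u = Num.sqrt (mxpair O u u).
Proof.
move=> [mu_ Iu]; rewrite /Lnrm unlock.
rewrite (@eq_integral _ _ _ _ _ (fun x => (mxdot (u x) (u x))%:E)); last first.
  move=> x _ /=; rewrite ger0_norm ?mxnorm_ge0//.
  by rewrite powR_mulrn ?mxnorm_ge0// mxnorm_sqr.
rewrite -[X in poweR X _]fineK; last exact: integrable_fin_num.
by rewrite poweR_EFin/= powR12_sqrt// mxpair_ge0.
Qed.

Definition L2nrm m n (u : E -> 'M[R]_(m, n)) := Num.sqrt (mxpair O u u).

Lemma L2nrm_ge0 m n (u : E -> 'M[R]_(m, n)) : 0 <= L2nrm u.
Proof. exact: sqrtr_ge0. Qed.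

Lemma L2nrm_sqr m n (u : E -> 'M[R]_(m, n)) : L2nrm u ^+ 2 = mxpair O u u.
Proof. by rewrite sqr_sqrtr// mxpair_ge0. Qed.

Lemma L2nrm_ae m n (u w : E -> 'M[R]_(m, n)) :
  measurable_fun setT u -> measurable_fun setT w ->
  {ae mu, forall x, u x = w x} -> L2nrm u = L2nrm w.
Proof.
move=> mu_ mw uw; congr Num.sqrt; apply: Rintegral_ae; try exact: measurable_mxdot.
by apply: filterS uw => x ->.
Qed.

Lemma L2nrmD m n (u w : E -> 'M[R]_(m, n)) : square_integrable u -> square_integrable w ->
  L2nrm (fun x => u x + w x) <= L2nrm u + L2nrm w.
Proof.
move=> su sw; have s1 := square_integrable_lin 1 su sw.
have E1 : {ae mu, forall x, u x + w x = 1 *: u x + w x}.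
  by apply: aeW => x; rewrite scale1r.
have suw : square_integrable (fun x => u x + w x).
  by move: s1; under eq_fun do rewrite scale1r.
rewrite -(@ler_pXn2r _ 2)// ?nnegrE ?addr_ge0 ?L2nrm_ge0// sqrrD !L2nrm_sqr.
rewrite (mxpair_linl suw.1 suw.1 E1); try exact: square_integrable_mxdot.
rewrite !(mxpairC _ (fun x => u x + w x)).
rewrite (mxpair_linl suw.1 su.1 E1); try exact: square_integrable_mxdot.
rewrite (mxpair_linl suw.1 sw.1 E1); try exact: square_integrable_mxdot.
rewrite (mxpairC w u).
have := mxpair_cs su sw; have := ler_norm (mxpair O u w); rewrite mulr2n /L2nrm; lra.
Qed.

Lemma L2nrmZ m n a (u : E -> 'M[R]_(m, n)) : square_integrable u ->
  L2nrm (fun x => a *: u x) = `|a| * L2nrm u.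
Proof.
move=> su; rewrite /L2nrm -[`|a|]sqrtr_sqr -sqrtrM ?sqr_ge0//; congr Num.sqrt.
rewrite /mxpair -RintegralZl//; last exact: su.2.
by apply: eq_Rintegral => x _; rewrite mxdotZl mxdotC mxdotZl mulrA.
Qed.

Lemma L2distE (u w : L2field O) : L2dist u w = L2nrm (fun x => u x - w x).
Proof.
rewrite /L2dist Lnrm2E//.
have := square_integrable_lin (-1) (square_integrable_L2 w) (square_integrable_L2 u).
by under eq_fun do rewrite scaleN1r addrC.
Qed.

Lemma L2distC (u w : L2field O) : L2dist u w = L2dist w u.
Proof.
rewrite !L2distE /L2nrm; congr Num.sqrt; apply: eq_Rintegral => x _.
by rewrite -opprB -scaleN1r mxdotZl mxdotC mxdotZl mulN1r mulN1r opprK.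
Qed.

Lemma L2dist_triangle (v u w : L2field O) : L2dist u w <= L2dist u v + L2dist v w.
Proof.
have sB (a b : L2field O) : square_integrable (fun x => a x - b x).
  have := square_integrable_lin (-1) (square_integrable_L2 b) (square_integrable_L2 a).
  by under eq_fun do rewrite scaleN1r addrC.
rewrite !L2distE; have := L2nrmD (sB u v) (sB v w).
by under [X in L2nrm X <= _ -> _]eq_fun do rewrite addrA subrK.
Qed.

Lemma L2dist0E (u : L2field O) : L2dist (L2zero O) u = L2nrm u.
Proof.
rewrite L2distC L2distE; apply: L2nrm_ae.
- by apply: measurable_mxB; exact: measurable_mxfield.
- exact: measurable_mxfield.
- by apply: filterS (field0P O) => x /= ->; rewrite subr0.
Qed.

(** Elements are classes modulo equality almost everywhere, so that this is
    Leibniz equality. *)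
Lemma L2fieldP (u w : L2field O) : {ae mu, forall x, u x = w x} -> u = w.
Proof.
case: u w => u Pu [w Pw] /= uw.
have uwE : u = w.
  rewrite -[u]reprK -[w]reprK; apply/eqmodP; apply/asboolP.
  by apply: filterS uw => x + _.
by move: Pu Pw; rewrite uwE => Pu Pw; congr MkL2field; exact: Prop_irrelevance.
Qed.

Lemma L2dist_eq0 (u w : L2field O) : L2dist u w = 0 -> u = w.
Proof.
have s : square_integrable (fun x => u x - w x).
  have := square_integrable_lin (-1) (square_integrable_L2 w) (square_integrable_L2 u).
  by under eq_fun do rewrite scaleN1r addrC.
rewrite L2distE => /(congr1 (fun x => x ^+ 2)); rewrite L2nrm_sqr expr0n => uw0.
apply: L2fieldP; apply: filterS (mxpair_eq0 s.2 uw0) => x /eqP.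
by rewrite subr_eq0 => /eqP.
Qed.

End pairings.

(** * Seminorms on finite-dimensional spaces *)

Section seminorms.
Context {R : realType} (V : vectType R).
Implicit Types u v : V.

Definition coord_nrm v : R := `|v2r v|.
Definition std_vec (i : 'I_(dim V)) : V := r2v (delta_mx 0 i).

Lemma coord_nrm_ge0 v : 0 <= coord_nrm v.
Proof. exact: normr_ge0. Qed.

Lemma coord_nrmD u v : coord_nrm (u + v) <= coord_nrm u + coord_nrm v.
Proof. by rewrite /coord_nrm linearD ler_normD. Qed.

Lemma coord_nrmZ a v : coord_nrm (a *: v) = `|a| * coord_nrm v.
Proof. by rewrite /coord_nrm linearZ normrZ. Qed.

Lemma coord_nrm_eq0 v : coord_nrm v = 0 -> v = 0.
Proof. by move=> /normr0_eq0 v0; rewrite -[v]v2rK v0 linear0. Qed.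

Lemma coord_le v i : `|v2r v 0 i| <= coord_nrm v.
Proof.
rewrite /coord_nrm [leRHS]/Num.norm /= mx_normrE.
by apply/bigmax_geP; right; exists (0, i).
Qed.

Lemma vec_coord v : v = \sum_i v2r v 0 i *: std_vec i.
Proof.
rewrite -{1}[v]v2rK {1}[v2r v]row_sum_delta linear_sum.
by apply: eq_bigr => i _; rewrite linearZ.
Qed.

Record seminorm (N : V -> R) : Prop := Seminorm {
  seminormD : forall u v, N (u + v) <= N u + N v ;
  seminormZ : forall a v, N (a *: v) = `|a| * N v }.

Variables (N : V -> R) (sN : seminorm N).

Lemma seminorm0 : N 0 = 0.
Proof. by rewrite -(scale0r (0 : V)) (seminormZ sN) normr0 mul0r. Qed.

Lemma seminormN v : N (- v) = N v.
Proof. by rewrite -scaleN1r (seminormZ sN) normrN1 mul1r. Qed.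

Lemma seminorm_ge0 v : 0 <= N v.
Proof.
have := seminormD sN v (- v); rewrite subrr seminorm0 seminormN; lra.
Qed.

Lemma seminorm_sum (I : Type) (s : seq I) (f : I -> V) :
  N (\sum_(i <- s) f i) <= \sum_(i <- s) N (f i).
Proof.
elim: s => [|i s ih]; first by rewrite !big_nil seminorm0.
by rewrite !big_cons (le_trans (seminormD sN _ _))// lerD2l.
Qed.

Definition seminorm_bound := \sum_i N (std_vec i).

Lemma seminorm_bound_ge0 : 0 <= seminorm_bound.
Proof. by apply: sumr_ge0 => i _; exact: seminorm_ge0. Qed.

Lemma seminorm_le v : N v <= seminorm_bound * coord_nrm v.
Proof.
rewrite {1}[v]vec_coord (le_trans (seminorm_sum _ _))// mulr_suml ler_sum// => i _.
by rewrite (seminormZ sN) mulrC ler_wpM2l ?seminorm_ge0// coord_le.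
Qed.

Lemma seminorm_lip u v : `|N u - N v| <= N (u - v).
Proof.
rewrite ler_norml; apply/andP; split.
  have := seminormD sN (v - u) u; rewrite subrK -(seminormN (v - u)) opprB; lra.
by have := seminormD sN (u - v) v; rewrite subrK; lra.
Qed.

Lemma seminorm_continuous : continuous (N \o r2v : 'rV[R]_(dim V) -> R).
Proof.
move=> c; apply/(@cvgrPdist_le _ _ _ _ (nbhs_filter c)) => e e0.
have cc : (fun t : 'rV[R]_(dim V) => t) @ c --> c by exact: cvg_id.
have C0 : 0 < seminorm_bound + 1 by rewrite ltr_wpDl// seminorm_bound_ge0.
near=> c'; rewrite /= (le_trans (seminorm_lip _ _))//.
rewrite (le_trans (seminorm_le _))// /coord_nrm -linearB/= r2vK.
apply: (@le_trans _ _ ((seminorm_bound + 1) * `|c - c'|)).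
  by rewrite ler_wpM2r// lerDl.
rewrite mulrC -ler_pdivlMr//; near: c'.
by apply: (@cvgr_dist_le _ _ _ _ (nbhs_filter c) _ _ cc); rewrite divr_gt0.
Unshelve. all: by end_near. Qed.

End seminorms.

(** Equivalence of norms on the subspace where the seminorms M q vanish: N attains
    a positive minimum on the compact set of its vectors of norm 1. *)
Lemma seminorm_coercive (R : realType) (V : vectType R) (N : V -> R)
    (Q : Type) (M : Q -> V -> R) :
  seminorm N -> (forall q, seminorm (M q)) ->
  (forall v, (forall q, M q v = 0) -> N v = 0 -> v = 0) ->
  exists2 C, 0 < C & forall v, (forall q, M q v = 0) -> coord_nrm v <= C * N v.
Proof.
move=> sN sM N0.
pose K : set 'rV[R]_(dim V) :=
  [set c | `|c| = 1] `&` \bigcap_(q in setT) ((M q \o r2v) @^-1` [set 0]).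
have hK v : v <> 0 -> (forall q, M q v = 0) -> K (v2r ((coord_nrm v)^-1 *: v)).
  move=> v0 Mv; have vn0 : coord_nrm v != 0 by apply/eqP => /coord_nrm_eq0.
  split => /=.
    rewrite -/(coord_nrm _) coord_nrmZ ger0_norm ?invr_ge0 ?coord_nrm_ge0// mulVf//.
  by move=> q _ /=; rewrite v2rK (seminormZ (sM q)) Mv mulr0.
have [K0|/set0P/negP/negPn/eqP K0] := pselect (K !=set0); last first.
  exists 1 => // v Mv; have [->|/eqP v0] := eqVneq v 0.
    by rewrite (seminorm0 sN) mulr0 /coord_nrm linear0 normr0.
  by have := hK _ v0 Mv; rewrite K0.
have Kb : bounded_set K.
  by exists 1; split => // x x1 c [/= -> _]; exact: ltW.
have Kc : closed K.
  apply: closedI.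
    apply: (@preimage_closed _ _ (fun c : 'rV[R]_(dim V) => `|c|) [set 1]).
      by move=> x _; exact: (@norm_continuous R 'rV[R]_(dim V) x).
    exact: (@closed_eq R^o).
  apply: closed_bigI => q _; apply: preimage_closed; last exact: (@closed_eq R^o).
  by move=> x _; exact: seminorm_continuous.
have [c0 Kc0 cmin] : exists2 c, c \in K & forall t, t \in K ->
  (N \o r2v) c <= (N \o r2v) t.
  apply: EVT_min_rV => //; first exact: bounded_closed_compact.
  by apply: continuous_subspaceT; exact: seminorm_continuous.
have m0 : 0 < N (r2v c0).
  rewrite lt_def (seminorm_ge0 sN) andbT; apply/eqP => /N0 c00.
  move: Kc0; rewrite inE => -[/= c1 Mc].
  have /c00 : forall q, M q (r2v c0) = 0 by move=> q; exact: (Mc q I).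
  move=> /(congr1 (@v2r _ _)); rewrite r2vK linear0 => c0E.
  by move: c1; rewrite c0E normr0 => /esym/eqP; rewrite oner_eq0.
exists (N (r2v c0))^-1; first by rewrite invr_gt0.
move=> v Mv; have [->|/eqP v0] := eqVneq v 0.
  by rewrite (seminorm0 sN) mulr0 /coord_nrm linear0 normr0.
have vn0 : 0 < coord_nrm v.
  by rewrite lt_def coord_nrm_ge0 andbT; apply/eqP => /coord_nrm_eq0.
have := cmin (v2r ((coord_nrm v)^-1 *: v)); rewrite inE => /(_ (hK _ v0 Mv)) /=.
rewrite v2rK (seminormZ sN) ger0_norm ?invr_ge0 ?coord_nrm_ge0//.
by rewrite ler_pdivlMl// => h; rewrite ler_pdivlMl// mulrC.
Qed.

(** * Linear and bilinear forms *)

Section linear_forms.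
Context {R : realType} (V : vectType R).

Definition linear_form (f : V -> R) := forall a u v, f (a *: u + v) = a * f u + f v.

Lemma linear_form0 f : linear_form f -> f 0 = 0.
Proof. by move=> lf; have := lf 1 0 0; rewrite scaler0 addr0 mul1r; lra. Qed.

Lemma linear_formZ f a v : linear_form f -> f (a *: v) = a * f v.
Proof. by move=> lf; rewrite -[a *: v]addr0 lf linear_form0// addr0. Qed.

Lemma linear_formD f u v : linear_form f -> f (u + v) = f u + f v.
Proof. by move=> lf; rewrite -[u]scale1r lf mul1r scale1r. Qed.

Lemma linear_formB f u v : linear_form f -> f (u - v) = f u - f v.
Proof. by move=> lf; rewrite addrC -scaleN1r lf mulN1r addrC. Qed.

Lemma linear_form_seminorm f : linear_form f -> seminorm (fun v => `|f v|).
Proof.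
move=> lf; split=> [u v|a v]; first by rewrite linear_formD// ler_normD.
by rewrite linear_formZ// normrM.
Qed.

Lemma bilinear_bound (T : V -> V -> R) :
  (forall w, linear_form (T ^~ w)) -> (forall v, linear_form (T v)) ->
  exists2 K, 0 <= K & forall v w, `|T v w| <= K * (coord_nrm v * coord_nrm w).
Proof.
move=> lT rT.
pose K := \sum_i seminorm_bound (fun w => `|T (std_vec i) w|).
exists K.
  by apply: sumr_ge0 => i _; apply: seminorm_bound_ge0; exact: linear_form_seminorm.
move=> v w; apply: le_trans (seminorm_le (linear_form_seminorm (lT w)) v) _.
rewrite [coord_nrm v * _]mulrC mulrA ler_wpM2r ?coord_nrm_ge0//.
rewrite /seminorm_bound mulr_suml ler_sum// => i _.
exact: (seminorm_le (linear_form_seminorm (rT (std_vec i)))).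
Qed.

End linear_forms.

(** * Reconstructed functions of a gradient discretisation *)

Section gd.
Context {R : realType} (d : nat) (O : polydom R d) (p kappa : R).
Hypotheses (hp : 1 < p) (hkappa : 0 <= kappa).
Variables (sigma : mxfield R O 1 d) (hsigma : W1oo_div sigma).
Variables (D : GD O) (hD : is_GD p D).
Local Notation mu := (leb O).
Local Notation V := (XD D).

Lemma conj_exp_gt1 : 1 < conj_exp p.
Proof. by rewrite /conj_exp ltr_pdivlMr ?subr_gt0// mul1r; lra. Qed.

Lemma conj_expV : p^-1 + (conj_exp p)^-1 = 1.
Proof.
have p0 : p != 0 by rewrite gt_eqF// (lt_trans ltr01).
have p1 : p - 1 != 0 by rewrite gt_eqF// subr_gt0.
by rewrite /conj_exp; field; rewrite p0 p1.
Qed.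

Lemma ae_linear0 (W : lmodType R) m n (F : W -> mxfield R O m n) :
  ae_linear O (fun v => F v) -> {ae mu, forall x, F 0 x = 0}.
Proof.
move=> lF; apply: filterS (lF 1 0 0) => x; rewrite scaler0 addr0 scale1r.
by move=> /eqP; rewrite -subr_eq subrr eq_sym => /eqP.
Qed.

Lemma ae_linear_sum (W : lmodType R) m n (F : W -> mxfield R O m n)
    (I : Type) (s : seq I) (c : I -> R) (e : I -> W) :
  ae_linear O (fun v => F v) ->
  {ae mu, forall x, F (\sum_(i <- s) c i *: e i) x = \sum_(i <- s) c i *: F (e i) x}.
Proof.
move=> lF; elim: s => [|i s ih].
  by apply: filterS (ae_linear0 lF) => x; rewrite !big_nil.
rewrite big_cons; move: ih (lF (c i) (e i) (\sum_(j <- s) c j *: e j)).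
by apply: filterS2 => x ih; rewrite big_cons ih.
Qed.

Definition PiD_pair (v w : V) := mxpair O (PiD v) (PiD w).
Definition PiD_nrm (v : V) := L2nrm O (PiD v).

Lemma square_integrable_Pi (v : V) : square_integrable O (PiD v).
Proof. exact: square_integrable_L2. Qed.

Lemma PiD_pairC v w : PiD_pair v w = PiD_pair w v.
Proof. exact: mxpairC. Qed.

Lemma PiD_pair_linear_form w : linear_form (PiD_pair ^~ w).
Proof.
move=> a u v; apply: mxpair_linl; try exact: measurable_mxfield.
- exact: (PiD_lin hD).
- by apply: square_integrable_mxdot; exact: square_integrable_Pi.
- by apply: square_integrable_mxdot; exact: square_integrable_Pi.
Qed.

Lemma PiD_pair_linear_formr v : linear_form (PiD_pair v).
Proof. by move=> a u w; rewrite PiD_pairC PiD_pair_linear_form !(PiD_pairC v). Qed.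

Lemma PiD_pairBl u v w : PiD_pair (u - v) w = PiD_pair u w - PiD_pair v w.
Proof. exact: (linear_formB _ _ (PiD_pair_linear_form w)). Qed.

Lemma PiD_nrm_sqr v : PiD_nrm v ^+ 2 = PiD_pair v v.
Proof. exact: L2nrm_sqr. Qed.

Lemma PiD_nrm_seminorm : seminorm PiD_nrm.
Proof.
split=> [u v|a v].
  rewrite /PiD_nrm (@L2nrm_ae _ _ _ _ _ _ (fun x => 1 *: PiD u x + PiD v x)); first last.
  - by apply: filterS (PiD_lin hD 1 u v) => x; rewrite [1 *: u]scale1r.
  - by apply: measurable_mxlin; exact: measurable_mxfield.
  - exact: measurable_mxfield.
  under [X in L2nrm _ X]eq_fun do rewrite scale1r.
  by apply: L2nrmD; exact: square_integrable_Pi.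
rewrite /PiD_nrm -L2nrmZ; last exact: square_integrable_Pi.
apply: L2nrm_ae; [exact: measurable_mxfield| |].
  have := @measurable_mxlin _ _ _ _ _ (a - 1) _ _ (measurable_mxfield (PiD v))
    (measurable_mxfield (PiD v)).
  by under eq_fun do rewrite scalerBl scale1r subrK.
move: (PiD_lin hD a v 0) (ae_linear0 (PiD_lin hD)).
by apply: filterS2 => x; rewrite addr0 => -> ->; rewrite addr0.
Qed.

Lemma L2dist_Pi v w : L2dist (PiD v) (PiD w) = PiD_nrm (v - w).
Proof.
rewrite L2distE; apply: L2nrm_ae; [|exact: measurable_mxfield|].
  by apply: measurable_mxB; exact: measurable_mxfield.
apply: filterS (PiD_lin hD (-1) w v) => x.
by rewrite !scaleN1r !(addrC (- _)) => ->.
Qed.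

(** * Divergence constraint *)

Definition div_pair (q : YD D) (v : V) := scpair O (chiD q) (divD v).

(** Young's inequality: one of the exponents p, p' is the smaller one, in which
    chi is integrable, and div is integrable in the other one. *)
Lemma rintegrable_chi_div (q : YD D) (v : V) :
  rintegrable mu (fun x => chiD q x * divD v x).
Proof.
have p1 := conj_exp_gt1; have pp := conj_expV.
have mc := measurable_scfield (chiD q).
have md := measurable_scfield (divD v).
have [dp dq] := divD_L hD v.
have := chiD_L hD q; have [pq|qp] := leP p (conj_exp p) => cL.
  apply: (@rintegrable_young _ _ _ _ _ p (conj_exp p)) => //; rewrite ?(lt_trans ltr01)//.
    exact: in_Lsc_rintegrable (ltW hp) _ _.
  exact: in_Lsc_rintegrable (ltW p1) _ _.
apply: (@rintegrable_young _ _ _ _ _ (conj_exp p) p) => //; rewrite ?(lt_trans ltr01)//.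
- by rewrite addrC.
- exact: in_Lsc_rintegrable (ltW p1) _ _.
- exact: in_Lsc_rintegrable (ltW hp) _ _.
Qed.

Lemma div_pair_linear_form q : linear_form (div_pair q).
Proof.
move=> a u v; rewrite /div_pair /scpair.
have Iu := rintegrableZ a (rintegrable_chi_div q u).
rewrite -RintegralZl//; last exact: rintegrable_chi_div.
rewrite -RintegralD//; last exact: rintegrable_chi_div.
apply: Rintegral_ae.
- exact: rintegrable_measurable (rintegrable_chi_div _ _).
- exact: rintegrable_measurable (rintegrableD Iu (rintegrable_chi_div _ _)).
- by apply: filterS (divD_lin hD a u v) => x ->; rewrite mulrDr mulrCA.
Qed.

Lemma scpair_chiB (q1 q0 : YD D) (v : V) :
  scpair O (fun x => chiD q1 x - chiD q0 x) (divD v) = div_pair q1 v - div_pair q0 v.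
Proof.
rewrite /div_pair /scpair -RintegralB//; try exact: rintegrable_chi_div.
by apply: eq_Rintegral => x _; rewrite mulrBl.
Qed.

Lemma div_pair_E0 q v : Y0 q -> E0 v -> div_pair q v = 0.
Proof. by move=> Yq; apply. Qed.

Lemma E0_lin a (u v : V) : E0 u -> E0 v -> E0 (a *: u + v).
Proof.
move=> Eu Ev q Yq; have := div_pair_linear_form q a u v; rewrite /div_pair => ->.
by rewrite Eu// Ev// mulr0 addr0.
Qed.

Lemma E0_zero : E0 (0 : V).
Proof. by move=> q Yq; exact: linear_form0 (div_pair_linear_form q). Qed.

(** The constraint defining E0 is the vanishing of the seminorms |div_pair q|, and
    the reconstruction is injective there. *)
Lemma PiD_nrm_coercive : exists2 C, 0 < C & forall v, E0 v ->
  coord_nrm v <= C * PiD_nrm v.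
Proof.
have h v : (forall q : {q : YD D | Y0 q}, `|div_pair (sval q) v| = 0) ->
  PiD_nrm v = 0 -> v = 0.
  move=> H v0; have Ev : E0 v.
    by move=> q Yq; have /eqP := H (exist _ q Yq); rewrite normr_eq0 => /eqP.
  apply: (PiD_inj hD); rewrite ?inE//; first exact: E0_zero.
  by apply: L2dist_eq0; rewrite L2dist_Pi subr0.
have [C C0 hC] := seminorm_coercive PiD_nrm_seminorm
  (fun q : {q : YD D | Y0 q} => linear_form_seminorm (div_pair_linear_form (sval q))) h.
exists C => // v Ev; apply: hC => -[q Yq] /=.
by rewrite div_pair_E0// normr0.
Qed.

(** * Viscous term *)

Lemma rintegrable_eps (v w : V) :
  rintegrable mu (fun x => mxnorm (epsD v x) * mxnorm (epsD w x)).
Proof.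
have p1 := conj_exp_gt1; have pp := conj_expV.
apply: (@rintegrable_young _ _ _ _ _ p (conj_exp p)) => //; rewrite ?(lt_trans ltr01)//.
- by apply: measurable_mxnorm; exact: measurable_mxfield.
- by apply: measurable_mxnorm; exact: measurable_mxfield.
- under eq_fun do rewrite ger0_norm ?mxnorm_ge0//.
  apply: in_L_rintegrable (ltW hp) _ _;
    [exact: measurable_mxfield|exact: (epsD_L hD v).1].
- under eq_fun do rewrite ger0_norm ?mxnorm_ge0//.
  apply: in_L_rintegrable (ltW p1) _ _;
    [exact: measurable_mxfield|exact: (epsD_L hD w).2].
Qed.

Definition energy_density (v : V) x := viscosity p kappa (mxnorm (epsD v x)) * mxnorm
  (epsD v x) ^+ 2.

Definition energy v := \int[mu]_x energy_density v x.

Definition stress_form (v w : V) :=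
  mxpair O (fun x => Sop p kappa (epsD v x)) (epsD w).

Lemma energy_density_ge0 v x : 0 <= energy_density v x.
Proof. by rewrite mulr_ge0 ?viscosity_ge0 ?sqr_ge0. Qed.

Lemma energy_ge0 v : 0 <= energy v.
Proof. by apply: Rintegral_ge0 => x _; exact: energy_density_ge0. Qed.

Lemma mxdot_Sop (v w : V) x : mxdot (Sop p kappa (epsD v x)) (epsD w x) =
  viscosity p kappa (mxnorm (epsD v x)) * mxdot (epsD v x) (epsD w x).
Proof. exact: mxdotZl. Qed.

Lemma energy_density_Sop v x : energy_density v x = mxdot (Sop p kappa (epsD v x))
  (epsD v x).
Proof. by rewrite mxdot_Sop /energy_density mxnorm_sqr. Qed.

Lemma stress_form_energy v : stress_form v v = energy v.
Proof. by apply: eq_Rintegral => x _; rewrite energy_density_Sop. Qed.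

Lemma measurable_energy_density v : measurable_fun setT (energy_density v).
Proof.
rewrite (funext (energy_density_Sop v)); apply: measurable_mxdot;
  last exact: measurable_mxfield.
by apply: measurable_Sop; exact: measurable_mxfield.
Qed.

Lemma rintegrable_energy_density v : rintegrable mu (energy_density v).
Proof.
have [C C0 hC] := energy_growth hp hkappa.
have I2 := rintegrable_eps v v.
have Ip := in_L_rintegrable (ltW hp) (measurable_mxfield (epsD v)) (epsD_L hD v).1.
apply: le_rintegrable (rintegrableZ C (rintegrableD I2 Ip)) _;
  first exact: measurable_energy_density.
apply: aeW => x /=; rewrite ger0_norm ?energy_density_ge0// -expr2.
by rewrite hC// mxnorm_ge0.
Qed.

(** The pointwise Young inequality [stress_young], integrated. *)
Lemma stress_form_bound l v w : 0 < l -> l <= 1 ->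
  `|stress_form v w| <= l^-1 * energy v + l `^ growth_exp p * energy w.
Proof.
move=> l0 l1.
have Iv := rintegrableZ l^-1 (rintegrable_energy_density v);
  have Iw := rintegrableZ (l `^ growth_exp p) (rintegrable_energy_density w).
have I := rintegrableD Iv Iw.
have le x : `|mxdot (Sop p kappa (epsD v x)) (epsD w x)|
    <= l^-1 * energy_density v x + l `^ growth_exp p * energy_density w x.
  apply: le_trans (stress_young hp hkappa l0 l1 (mxnorm_ge0 (epsD v x)) (mxnorm_ge0
    (epsD w x))).
  rewrite mxdot_Sop normrM ger0_norm ?viscosity_ge0// -mulrA ler_wpM2l ?viscosity_ge0//.
  exact: mxdot_cs.
have Ia : rintegrable mu (fun x => mxdot (Sop p kappa (epsD v x)) (epsD w x)).
  apply: le_rintegrable I (aeW _ le); apply: measurable_mxdot;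
    last exact: measurable_mxfield.
  by apply: measurable_Sop; exact: measurable_mxfield.
rewrite /stress_form /mxpair (le_trans (le_normr_Rintegral _ _))//.
rewrite /energy -!RintegralZl//; try exact: rintegrable_energy_density.
rewrite -RintegralD//; apply: le_Rintegral => //.
exact: integrable_norm Ia.
Qed.

Lemma energy_mono (v w : V) : {ae mu, forall x, mxnorm (epsD v x) <= mxnorm (epsD w x)} ->
  energy v <= energy w.
Proof.
move=> vw; apply: ae_le_Rintegral; try exact: rintegrable_energy_density.
by apply: filterS vw => x vw; apply: energy_le => //; exact: mxnorm_ge0.
Qed.

Lemma epsZ a (v : V) : {ae mu, forall x, epsD (a *: v) x = a *: epsD v x}.
Proof.
move: (epsD_lin hD a v 0) (ae_linear0 (epsD_lin hD)).
by apply: filterS2 => x; rewrite addr0 => -> ->; rewrite addr0.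
Qed.

Lemma energyZ a b v : `|a| <= b -> energy (a *: v) <= energy (b *: v).
Proof.
move=> ab; apply: energy_mono; move: (epsZ a v) (epsZ b v).
apply: filterS2 => x -> ->; rewrite !mxnormZ ler_wpM2r ?mxnorm_ge0//.
by rewrite (le_trans ab)// ler_norm.
Qed.

(** At each point the strain of u + v is at most twice the larger one. *)
Lemma energyD u v : energy (u + v) <= energy (2 *: u) + energy (2 *: v).
Proof.
rewrite /energy -RintegralD//; try exact: rintegrable_energy_density.
apply: ae_le_Rintegral; first exact: rintegrable_energy_density.
  by apply: rintegrableD; exact: rintegrable_energy_density.
move: (epsD_lin hD 1 u v) (epsZ 2 u) (epsZ 2 v).
apply: filterS3 => x; rewrite !scale1r /energy_density => -> -> ->.
have e0 n (A : 'M[R]_n) : 0 <= viscosity p kappa (mxnorm A) * mxnorm A ^+ 2.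
  by rewrite mulr_ge0 ?viscosity_ge0 ?sqr_ge0.
have [uv|vu] := leP (mxnorm (epsD u x)) (mxnorm (epsD v x)).
  rewrite -[leLHS]add0r lerD//; apply: energy_le; rewrite ?mxnorm_ge0//.
  by rewrite mxnormZ ger0_norm// (le_trans (mxnormD _ _))// mulr2n mulrDl mul1r lerD2r.
rewrite -[leLHS]addr0 lerD//; apply: energy_le; rewrite ?mxnorm_ge0//.
by rewrite mxnormZ ger0_norm// (le_trans (mxnormD _ _))// mulr2n mulrDl mul1r lerD2l ltW.
Qed.

(** By induction on the terms of the coordinate expansion, splitting off one term
    with [energyD]; the bound M doubles at each step. *)
Lemma energy_bounded M : exists K, forall v, coord_nrm v <= M -> energy v <= K.
Proof.
suff [K hK] : exists K, forall c : 'I_(dim V) -> R, (forall i, `|c i| <= M) ->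
    energy (\sum_i c i *: std_vec i) <= K.
  exists K => v vM; rewrite [v]vec_coord; apply: hK => i.
  exact: le_trans (coord_le _ _) vM.
elim: (index_enum _) M => [|i s ih] M.
  by exists (energy 0) => c _; rewrite big_nil.
have [K hK] := ih (2 * M); exists (energy ((2 * M) *: std_vec i) + K) => c cM.
rewrite big_cons (le_trans (energyD _ _))// lerD//.
  by rewrite scalerA energyZ// normrM ger0_norm// ler_pM2l.
rewrite scaler_sumr; under eq_bigr do rewrite scalerA.
by apply: hK => j; rewrite normrM ger0_norm// ler_pM2l.
Qed.

(** * Coercivity of the dissipation *)

Definition strain_sum x := \sum_i mxnorm (epsD (@std_vec _ V i) x) ^+ 2.

(** An integrable weight with values in [0, 1] that vanishes only where all strains
    do; with it, strains become integrable to the power 1 as well. *)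
Definition strain_weight x := Num.min 1 (strain_sum x).

Lemma strain_sum_ge0 x : 0 <= strain_sum x.
Proof. by apply: sumr_ge0 => i _; exact: sqr_ge0. Qed.

Lemma strain_weight_ge0 x : 0 <= strain_weight x.
Proof. by rewrite /strain_weight le_min ler01 strain_sum_ge0. Qed.

Lemma rintegrable_strain_sum : rintegrable mu strain_sum.
Proof.
apply: rintegrable_sum => i; have := rintegrable_eps (@std_vec _ V i) (@std_vec _ V i).
by under eq_fun do rewrite -expr2.
Qed.

Lemma measurable_strain_weight : measurable_fun setT strain_weight.
Proof.
by apply: measurable_minr => //; exact: rintegrable_measurable rintegrable_strain_sum.
Qed.

Lemma rintegrable_strain_weight : rintegrable mu strain_weight.
Proof.
apply: le_rintegrable rintegrable_strain_sum _; first exact: measurable_strain_weight.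
by apply: aeW => x; rewrite ger0_norm ?strain_weight_ge0// /strain_weight ge_min lexx
  orbT.
Qed.

Definition weighted_nrm (v : V) := \int[mu]_x (mxnorm (epsD v x) * strain_weight x).

Lemma rintegrable_weighted_nrm (v : V) :
  rintegrable mu (fun x => mxnorm (epsD v x) * strain_weight x).
Proof.
apply: le_rintegrable (rintegrableD (rintegrable_eps v v) rintegrable_strain_weight) _.
  apply: measurable_funM; last exact: measurable_strain_weight.
  by apply: measurable_mxnorm; exact: measurable_mxfield.
apply: aeW => x; have o0 := strain_weight_ge0 x; have n0 := mxnorm_ge0 (epsD v x).
have o1 : strain_weight x <= 1 by rewrite /strain_weight ge_min lexx.
rewrite ger0_norm ?mulr_ge0//; nra.
Qed.

Lemma weighted_nrm_seminorm : seminorm weighted_nrm.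
Proof.
split=> [u v|a v].
  rewrite /weighted_nrm -RintegralD//; try exact: rintegrable_weighted_nrm.
  apply: ae_le_Rintegral; first exact: rintegrable_weighted_nrm.
    by apply: rintegrableD; exact: rintegrable_weighted_nrm.
  apply: filterS (epsD_lin hD 1 u v) => x; rewrite !scale1r => ->.
  by rewrite -mulrDl ler_wpM2r ?strain_weight_ge0// mxnormD.
rewrite /weighted_nrm -RintegralZl//; last exact: rintegrable_weighted_nrm.
apply: Rintegral_ae.
- exact: rintegrable_measurable (rintegrable_weighted_nrm _).
- exact: rintegrable_measurable (rintegrableZ _ (rintegrable_weighted_nrm _)).
- by apply: filterS (epsZ a v) => x ->; rewrite mxnormZ mulrA.
Qed.

Lemma weighted_nrm_eq0 v : weighted_nrm v = 0 -> v = 0.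
Proof.
move=> /(Rintegral_eq0 (rintegrable_weighted_nrm v)) H.
have {}H := H (fun x => mulr_ge0 (mxnorm_ge0 _) (strain_weight_ge0 x)).
apply: (epsD_norm hD).
have vE := @ae_linear_sum _ _ _ _ _ (index_enum _) (v2r v 0) (@std_vec _ V)
  (epsD_lin hD).
have ev0 : {ae mu, forall x, epsD v x = 0}.
  move: H vE; apply: filterS2 => x; rewrite -vec_coord => /eqP.
  rewrite mulf_eq0 => /orP[/eqP/mxnorm_eq0//|].
  rewrite /strain_weight; have [//|] := leP; first by rewrite oner_eq0.
  move=> _ /eqP/psumr_eq0P e0 ->; rewrite big1// => i _.
  have /eqP : mxnorm (epsD (@std_vec _ V i) x) ^+ 2 = 0.
    by apply: e0 => // j _; exact: sqr_ge0.
  by rewrite sqrf_eq0 => /eqP/mxnorm_eq0 ->; rewrite scaler0.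
have p0 : p != 0 by rewrite gt_eqF// (lt_trans ltr01).
rewrite /Lnrm unlock (@ge0_ae_eq_integral _ _ _ _ _ _ (cst 0%E))//=.
- by rewrite integral0 poweR0r// invr_neq0.
- apply/measurable_EFinP.
  apply: (measurableT_comp (measurable_powR _)).
  by apply: measurableT_comp => //; apply: measurable_mxnorm; exact: measurable_mxfield.
- apply: filterS ev0 => x -> _ /=.
  by rewrite mxnorm0 normr0 powR0.
Qed.

(** Integrating [le_stress_energy] against the weight bounds the weighted norm by
    an arbitrarily small constant plus a multiple of the dissipation. *)
Lemma energy_coercive e : 0 < e ->
  exists2 dl, 0 < dl & forall v, energy v < dl -> coord_nrm v < e.
Proof.
move=> e0; have [C C0 hC] := @seminorm_coercive _ V weighted_nrm False (fun _ _ => 0)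
  weighted_nrm_seminorm (fun f => match f with end) (fun v _ => @weighted_nrm_eq0 v).
pose I := \int[mu]_x strain_weight x.
have I0 : 0 <= I by apply: Rintegral_ge0 => x _; exact: strain_weight_ge0.
(* The slack h leaves half of e; adding 1 covers a weight of zero integral. *)
pose h := e / (2 * C * (I + 1)).
have CI : 0 < 2 * C * (I + 1) by rewrite !mulr_gt0// ltr_wpDl.
have h0 : 0 < h by rewrite divr_gt0.
pose k := viscosity p kappa h * h.
have k0 : 0 < k by rewrite mulr_gt0// viscosity_gt0.
exists (e * k / (2 * C)); first by rewrite divr_gt0// mulr_gt0.
move=> v; rewrite ltr_pdivlMr ?mulr_gt0// => vd.
apply: le_lt_trans (hC v (fun f => match f with end)) _.
have : weighted_nrm v <= h * I + k^-1 * energy v.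
  rewrite /weighted_nrm /I /energy -!RintegralZl//;
    try exact: rintegrable_strain_weight; try exact: rintegrable_energy_density.
  have I1 := rintegrableZ h rintegrable_strain_weight;
    have I2 := rintegrableZ k^-1 (rintegrable_energy_density v).
  rewrite -RintegralD//; apply: le_Rintegral => //; first exact: rintegrable_weighted_nrm.
    exact: rintegrableD.
  move=> x _; have o0 := strain_weight_ge0 x; have n0 := mxnorm_ge0 (epsD v x).
  have o1 : strain_weight x <= 1 by rewrite /strain_weight ge_min lexx.
  apply: (@le_trans _ _ ((h + k^-1 * energy_density v x) * strain_weight x)).
    rewrite ler_wpM2r//; exact: (le_stress_energy hp hkappa).
  rewrite mulrDl lerD2l ler_piMr// mulr_ge0 ?energy_density_ge0// invr_ge0 ltW//.
move=> wl; apply: (@le_lt_trans _ _ (C * (h * I + k^-1 * energy v))).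
  by rewrite ler_pM2l.
have -> : e = e / 2 + e / 2 by lra.
rewrite mulrDr ler_ltD//.
  have hE : h * (2 * C * (I + 1)) = e by rewrite /h divfK// gt_eqF.
  have Ch : 0 < C * h by rewrite mulr_gt0.
  clearbody h; nra.
rewrite mulrCA ltr_pdivrMl//; lra.
Qed.

(** * Noise form *)

Definition transport (v w : V) := mxpair O (fun x => sigma x *m nablaD v x) (PiD w).

Lemma measurable_snabla (v : V) : measurable_fun setT (fun x => sigma x *m nablaD v x).
Proof. by apply: measurable_mxmul; exact: measurable_mxfield. Qed.

(** The coefficient sigma is essentially bounded, and the other two factors are in
    L^p and L^p'. *)
Lemma rintegrable_noise (v w : V) :
  rintegrable mu (fun x => mxdot (sigma x *m nablaD v x) (PiD w x)).
Proof.
have [G [[M sM] _ _]] := hsigma.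
have p1 := conj_exp_gt1; have pp := conj_expV.
have I : rintegrable mu (fun x => mxnorm (nablaD v x) * mxnorm (PiD w x)).
  apply: (@rintegrable_young _ _ _ _ _ p (conj_exp p)) => //; rewrite ?(lt_trans ltr01)//.
  - by apply: measurable_mxnorm; exact: measurable_mxfield.
  - by apply: measurable_mxnorm; exact: measurable_mxfield.
  - under eq_fun do rewrite ger0_norm ?mxnorm_ge0//.
    apply: in_L_rintegrable (ltW hp) _ _;
      [exact: measurable_mxfield|exact: (nablaD_L hD v).1].
  - under eq_fun do rewrite ger0_norm ?mxnorm_ge0//.
    apply: in_L_rintegrable (ltW p1) _ _;
      [exact: measurable_mxfield|exact: (PiD_L hD w).2].
apply: le_rintegrable (rintegrableZ M I) _.
  by apply: measurable_mxdot; [exact: measurable_snabla|exact: measurable_mxfield].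
apply: filterS sM => x [sM _]; apply: le_trans (mxdot_cs _ _) _.
rewrite mulrA ler_wpM2r ?mxnorm_ge0// (le_trans (mxnorm_mul _ _))//.
by rewrite ler_wpM2r ?mxnorm_ge0.
Qed.

Lemma transport_linear_forml w : linear_form (transport ^~ w).
Proof.
move=> a u v; apply: mxpair_linl;
  [exact: measurable_snabla|exact: measurable_mxfield| | |].
- apply: filterS (nablaD_lin hD a u v) => x ->.
  by rewrite mulmxDr -scalemxAr.
- exact: rintegrable_noise.
- exact: rintegrable_noise.
Qed.

Lemma transport_linear_formr v : linear_form (transport v).
Proof.
move=> a u w; apply: mxpair_linr;
  [exact: measurable_mxfield|exact: measurable_snabla| | |].
- exact: (PiD_lin hD).
- exact: rintegrable_noise.
- exact: rintegrable_noise.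
Qed.

(** Makes the antisymmetry of the noise form explicit. *)
Lemma BsigmaE (v w : V) : Bsigma sigma v w = 2^-1 * (transport v w - transport w v).
Proof. by rewrite /Bsigma (mxpairC O (PiD v)) -mulrBr. Qed.

Lemma Bsigma_bound :
  exists2 K, 0 <= K & forall v w :
    V, `|Bsigma sigma v w| <= K * (coord_nrm v * coord_nrm w).
Proof.
have [K K0 hK] := bilinear_bound transport_linear_forml transport_linear_formr.
exists K => // v w; rewrite BsigmaE normrM ger0_norm; last by rewrite invr_ge0.
have h : `|transport v w - transport w v| <= 2 * (K * (coord_nrm v * coord_nrm w)).
  rewrite (le_trans (ler_normB _ _))// mulr2n mulrDl mul1r lerD//.
  by rewrite (mulrC (coord_nrm v)).
by rewrite mulrC ler_pdivrMr// mulrC.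
Qed.

(** * One time step *)

Section step.
Variables (tau dW : R) (v0 v1 : V) (q0 q1 : YD D).
Hypotheses (Y0q0 : Y0 q0) (Y0q1 : Y0 q1) (Ev0 : E0 v0)
  (st : time_step p kappa sigma tau dW v0 v1 q0 q1).

Lemma step_midpoint : E0 (midpoint v0 v1).
Proof.
by move=> q Yq; rewrite -(st.2 q Yq); apply: eq_Rintegral => x _; rewrite mulrC.
Qed.

Lemma step_E0 : E0 v1.
Proof.
have -> : v1 = 2 *: midpoint v0 v1 + (-1) *: v0 + 0.
  by rewrite /midpoint scalerA divff// scale1r scaleN1r addr0 addrK.
by rewrite -addrA; apply: E0_lin step_midpoint _; apply: E0_lin Ev0 E0_zero.
Qed.

(** On E0 the pressure terms vanish. *)
Lemma step_test xi : E0 xi ->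
  PiD_pair (v1 - v0) xi + tau * stress_form (midpoint v0 v1) xi =
  Bsigma sigma (midpoint v0 v1) xi * dW.
Proof.
move=> Exi; rewrite -(st.1 xi) scpair_chiB !div_pair_E0// subrr subr0; congr (_ + _).
rewrite mxpairB; try exact: measurable_mxfield; try (by apply: square_integrable_mxdot;
  exact: square_integrable_Pi).
by rewrite PiD_pairBl.
Qed.

(** The test function is the midpoint, on which the antisymmetric noise form
    vanishes. *)
Lemma step_energy :
  PiD_nrm v1 ^+ 2 + 2 * tau * energy (midpoint v0 v1) = PiD_nrm v0 ^+ 2.
Proof.
have := step_test step_midpoint.
rewrite BsigmaE subrr mulr0 mul0r stress_form_energy.
rewrite /midpoint (linear_formZ _ _ (PiD_pair_linear_formr _)) (linear_formD _ _
  (PiD_pair_linear_formr _)).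
rewrite !PiD_pairBl (PiD_pairC v0 v1) -!PiD_nrm_sqr => h.
set e := energy _ in h *; lra.
Qed.

Lemma step_increment :
  PiD_nrm (v1 - v0) ^+ 2 + tau * stress_form (midpoint v0 v1) (v1 - v0) =
  Bsigma sigma (midpoint v0 v1) (v1 - v0) * dW.
Proof.
rewrite PiD_nrm_sqr step_test// addrC -scaleN1r; apply: E0_lin => //; exact: step_E0.
Qed.

End step.

End gd.

(** * Long-time behaviour of one trajectory *)

Section trajectory.
Context {R : realType} (d : nat) (O : polydom R d) (p kappa : R).
Hypotheses (hp : 1 < p) (hkappa : 0 <= kappa).
Variables (sigma : mxfield R O 1 d) (hsigma : W1oo_div sigma).
Variables (D : GD O) (hD : is_GD p D).
Variables (tau : R) (htau : 0 < tau).
Variables (v : nat -> XD D) (q : nat -> YD D) (dW : nat -> R).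
Hypotheses (hq : forall n, Y0 (q n)) (hv0 : E0 (v 0)).
Hypothesis hstep : forall n,
  time_step p kappa sigma tau (dW n) (v n) (v n.+1) (q n) (q n.+1).

Let mid n := midpoint (v n) (v n.+1).

Lemma trajectory_E0 n : E0 (v n).
Proof.
by elim: n => [//|n ih]; exact: (step_E0 hp hD ih (hstep n)).
Qed.

Let energy_balance n :
  PiD_nrm (v n.+1) ^+ 2 + 2 * tau * energy p kappa (mid n) = PiD_nrm (v n) ^+ 2.
Proof.
exact: (step_energy hp hD (hq n) (hq n.+1) (hstep n)).
Qed.

Lemma trajectory_sqr_decreasing n : PiD_nrm (v n.+1) ^+ 2 <= PiD_nrm (v n) ^+ 2.
Proof.
by rewrite -(energy_balance n) lerDl mulr_ge0 ?energy_ge0// mulr_ge0// ltW.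
Qed.

Lemma trajectory_decreasing : {homo (fun n => PiD_nrm (v n)) :
  m n / (m <= n)%N >-> n <= m}.
Proof.
apply/nonincreasing_seqP => n.
by rewrite -(@ler_pXn2r _ 2)// ?nnegrE ?L2nrm_ge0// trajectory_sqr_decreasing.
Qed.

(** The dissipation is the decrement of a convergent sequence. *)
Lemma energy_midpoint_cvg : energy p kappa (mid n) @[n --> \oo] --> 0.
Proof.
have c : cvgn (fun n => PiD_nrm (v n) ^+ 2).
  apply: nonincreasing_is_cvgn.
    by apply/nonincreasing_seqP => n; exact: trajectory_sqr_decreasing.
  by exists 0 => _ [n _ <-]; exact: sqr_ge0.
have -> : (fun n => energy p kappa (mid n)) =
    (fun n => (2 * tau)^-1 * (PiD_nrm (v n) ^+ 2 - PiD_nrm (v n.+1) ^+ 2)).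
  apply/funext => n; rewrite -(energy_balance n) addrC addKr mulKf//.
  by rewrite gt_eqF// mulr_gt0.
rewrite -(mulr0 (2 * tau)^-1); apply: cvgMr.
rewrite -(subrr (limn (fun n => PiD_nrm (v n) ^+ 2))); apply: cvgB => //.
by have := c; rewrite -(cvg_shiftS (fun n => PiD_nrm (v n) ^+ 2)).
Qed.

Lemma coord_nrm_midpoint_cvg : coord_nrm (mid n) @[n --> \oo] --> 0.
Proof.
apply/cvgr0Pnorm_lt => e e0; have [dl dl0 hdl] := energy_coercive hp hkappa hD e0.
move/cvgr0Pnorm_lt : energy_midpoint_cvg => /(_ _ dl0).
by apply: filterS => n; rewrite !ger0_norm ?coord_nrm_ge0 ?energy_ge0//; exact: hdl.
Qed.

Lemma PiD_nrm_midpoint_cvg : PiD_nrm (mid n) @[n --> \oo] --> 0.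
Proof.
have s := PiD_nrm_seminorm hD.
apply: (@squeeze_cvgr _ _ _ _ (fun=> 0) (fun n => seminorm_bound (@PiD_nrm _ _ _ D) *
  coord_nrm (mid n))).
- by apply: nearW => n; rewrite L2nrm_ge0/= seminorm_le.
- exact: cvg_cst.
- rewrite -(mulr0 (seminorm_bound (@PiD_nrm _ _ _ D))).
  by apply: cvgMr; exact: coord_nrm_midpoint_cvg.
Qed.

Hypothesis hdW : exists K, forall N, exists2 n, (N <= n)%N & `|dW n| <= K.

(** The increment is tested with itself at a time when the Wiener increment is at
    most K; the velocity is the midpoint minus half of the increment. *)
Lemma PiD_nrm_small e : 0 < e -> exists n, PiD_nrm (v n) < e.
Proof.
move=> e0; have [K hK] := hdW.
have [C C0 hC] := PiD_nrm_coercive hp hD.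
have [B B0 hB] := Bsigma_bound hp hsigma hD.
pose M := C * PiD_nrm (v 0).
have M0 : 0 <= M by exact: mulr_ge0 (ltW C0) (L2nrm_ge0 _ _).
have vM n : coord_nrm (v n) <= M.
  apply: le_trans (hC _ (trajectory_E0 n)) _; rewrite ler_pM2l//.
  exact: trajectory_decreasing.
have dM n : coord_nrm (v n.+1 - v n) <= 2 * M.
  rewrite (le_trans (coord_nrmD _ _))// -scaleN1r coord_nrmZ normrN1 mul1r mulr2n mulrDl.
  by rewrite mul1r lerD.
clearbody M.
have [L hL] := energy_bounded hp hkappa hD (2 * M).
have K0 : 0 <= K by have [n _] := hK 0; apply: le_trans; exact: normr_ge0.
have L0 : 0 <= L by apply: le_trans (hL _ (dM 0)); exact: energy_ge0.
(* A third of e^2 for each part of the viscous bound and for the noise. *)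
pose h := e ^+ 2 / 3.
have h0 : 0 < h by rewrite divr_gt0// exprn_gt0.
have a0 := growth_exp_gt0 hp.
(* l is so small that the test-function part of the viscous term is below h. *)
have [l [l0 l1 hl]] : exists l, [/\ 0 < l, l <= 1 & tau * (l `^ growth_exp p * L) < h].
  pose y := h / (tau * (L + 1)).
  have y0 : 0 < y by rewrite divr_gt0 ?mulr_gt0// ltr_wpDl.
  exists (Num.min 1 (y `^ (growth_exp p)^-1)); split.
  - by rewrite lt_min ltr01 powR_gt0.
  - by rewrite ge_min lexx.
  - apply: (@le_lt_trans _ _ (tau * (y * L))).
      rewrite ler_pM2l// ler_wpM2r//.
      have {2}-> : y = (y `^ (growth_exp p)^-1) `^ growth_exp p.
        by rewrite -powRrM mulVf ?gt_eqF// powRr1// ltW.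
      rewrite ge0_ler_powR ?nnegrE ?powR_ge0 ?(ltW a0)//.
        by rewrite le_min ler01 powR_ge0.
      by rewrite ge_min lexx orbT.
    have yE : y * (tau * (L + 1)) = h.
      by rewrite /y divfK// gt_eqF// mulr_gt0// ltr_wpDl.
    by rewrite -yE mulrCA ltr_pM2l// ltr_pM2l// ltrDl.
have c1 : tau * l^-1 * energy p kappa (mid n) @[n --> \oo] --> 0.
  rewrite -(mulr0 (tau * l^-1)); apply: cvgMr; exact: energy_midpoint_cvg.
have c2 : B * (2 * M) * K * coord_nrm (mid n) @[n --> \oo] --> 0.
  rewrite -(mulr0 (B * (2 * M) * K)); apply: cvgMr; exact: coord_nrm_midpoint_cvg.
have e20 : 0 < e / 2 by rewrite divr_gt0.
move/cvgr0Pnorm_lt : c1 => /(_ _ h0) [N1 _ H1].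
move/cvgr0Pnorm_lt : c2 => /(_ _ h0) [N2 _ H2].
move/cvgr0Pnorm_lt : PiD_nrm_midpoint_cvg => /(_ _ e20) [N3 _ H3].
have [n] := hK (maxn N1 (maxn N2 N3)).
rewrite !geq_max => /and3P[n1 n2 n3] dWn; exists n.
have {H1} := H1 n n1; have {H2} := H2 n n2; have {H3} := H3 n n3.
rewrite /= !ger0_norm ?L2nrm_ge0 ?mulr_ge0 ?energy_ge0 ?coord_nrm_ge0 ?invr_ge0 ?(ltW
  htau) ?(ltW l0)//.
move=> H3 H2 H1.
have := step_increment hp hD (hq n) (hq n.+1) (trajectory_E0 n) (hstep n).
set dn := v n.+1 - v n; rewrite -/(mid n) => hinc.
have ha := stress_form_bound hp hkappa hD (mid n) dn l0 l1.
have hd : energy p kappa dn <= L by exact: hL (dM n).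
have hb : `|Bsigma sigma (mid n) dn * dW n| <= B * (2 * M) * K * coord_nrm (mid n).
  rewrite normrM (_ : B * (2 * M) * K * coord_nrm (mid n) = B * (coord_nrm (mid n) * (2
    * M)) * K); last by ring.
  rewrite ler_pM// (le_trans (hB _ _))// ler_wpM2l// ler_wpM2l ?coord_nrm_ge0//.
  exact: dM.
have h3 : PiD_nrm dn ^+ 2 < e ^+ 2.
  have ha' : tau * `|stress_form p kappa (mid n) dn| <=
      tau * l^-1 * energy p kappa (mid n) + tau * (l `^ growth_exp p * L).
    by rewrite -mulrA -mulrDr ler_pM2l// (le_trans ha)// lerD2l ler_wpM2l// powR_ge0.
  have eE : e ^+ 2 = h + h + h by rewrite /h; field.
  have : - (tau * stress_form p kappa (mid n) dn) <= tau * `|stress_form p kappa (mid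
    n) dn|.
    by rewrite -mulrN ler_pM2l// -normrN ler_norm.
  have := ler_norm (Bsigma sigma (mid n) dn * dW n); lra.
have hd' : PiD_nrm dn < e.
  by rewrite -(@ltr_pXn2r _ 2)// ?nnegrE ?L2nrm_ge0 ?(ltW e0).
have s := PiD_nrm_seminorm hD.
have -> : v n = mid n + (- 2^-1) *: dn.
  rewrite /mid /midpoint /dn scaleNr -scalerBr opprB [X in _ *: X]addrC addrA subrK.
  by rewrite -mulr2n -(scaler_nat 2 (v n)) scalerA mulVf// scale1r.
rewrite (le_lt_trans (seminormD s _ _))// (seminormZ s (- 2^-1) dn) normrN ger0_norm//;
  lra.
Qed.

Lemma trajectory_cvg : PiD_nrm (v n) @[n --> \oo] --> 0.
Proof.
apply/cvgr0Pnorm_lt => e e0; have [n hn] := PiD_nrm_small e0.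
exists n => // m /= nm; rewrite ger0_norm ?L2nrm_ge0//.
by apply: le_lt_trans hn; exact: trajectory_decreasing.
Qed.

End trajectory.

(** * Recurrence of identically distributed variables *)

Section recurrence.
Context {R : realType} d' (Omega : measurableType d') (P : probability Omega R).

(** The event that |X n| > K for all n >= N has probability at most
    P (|X N| > K) = P (|X 0| > K), uniformly in N, and
    this tends to 0 as K tends to infinity. *)
Lemma identically_distributed_recurrent (X : nat -> Omega -> R) :
  (forall n, measurable_fun setT (X n)) ->
  (forall n B, measurable B -> P (X n @^-1` B) = P (X 0%N @^-1` B)) ->
  {ae P, forall w, exists K, forall N, exists2 n, (N <= n)%N & `|X n w| <= K}.
Proof.
move=> mX lawX.
pose far (K : nat) : set R := [set x | K%:R < `|x|].
have mfar K : measurable (far K).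
  rewrite -[far K]setTI; apply: (measurable_fun_ltr (f := fun=> K%:R) (g := fun x :
    R => `|x|)) => //.
have mXB n B : measurable B -> measurable (X n @^-1` B).
  by move=> mB; rewrite -[_ @^-1` _]setTI; exact: mX.
(* The event that the variables exceed K from time N on. *)
pose tail K N := \bigcap_(n in [set n | (N <= n)%N]) (X n @^-1` far K).
have mtail K N : measurable (tail K N) by apply: bigcap_measurableType => n _; exact: mXB.
have tail_le K : (P (\bigcup_N tail K N) <= P (X 0%N @^-1` far K))%E.
  have c : P (tail K N) @[N --> \oo] --> P (\bigcup_N tail K N).
    apply: nondecreasing_cvg_mu => //; first exact: bigcupT_measurable.
    move=> N N' NN'; apply/subsetPset => w h n /= nN'; apply: h => /=.
    exact: leq_trans NN' nN'.
  rewrite -(cvg_lim _ c)//; apply: lime_le; first by apply/cvg_ex; eexists; exact: c.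
  apply: nearW => N; rewrite -(lawX N)//; apply: le_measure; rewrite ?inE//.
    exact: mXB.
  by move=> w /(_ N) h; apply: h => /=.
have far0 : P (X 0%N @^-1` far K) @[K --> \oo] --> 0%E.
  have -> : 0%E = P (\bigcap_K (X 0%N @^-1` far K)).
    rewrite (_ : \bigcap_K _ = set0) ?measure0// -subset0 => w /= h.
    have := archi_boundP (normr_ge0 (X 0%N w)); apply/negP; rewrite -leNgt.
    by apply: ltW; exact: h.
  apply: nonincreasing_cvg_mu.
  - by rewrite (le_lt_trans (probability_le1 _ _)) ?ltry//; exact: mXB.
  - by move=> K; exact: mXB.
  - by apply: bigcap_measurableType => K _; exact: mXB.
  - move=> K K' KK'; apply/subsetPset => w /=; apply: le_lt_trans.
    by rewrite ler_nat.
exists (\bigcap_K \bigcup_N tail K N); split.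
- by apply: bigcap_measurableType => K _; exact: bigcupT_measurable.
- apply/eqP; rewrite eq_le measure_ge0 andbT.
  rewrite -(cvg_lim _ far0)//; apply: lime_ge; first by apply/cvg_ex; eexists;
    exact: far0.
  apply: nearW => K; apply: le_trans (tail_le K); apply: le_measure; rewrite ?inE//.
  + by apply: bigcap_measurableType => k _; exact: bigcupT_measurable.
  + exact: bigcupT_measurable.
  + by move=> w; apply.
- move=> w /= /forallNP nK K _.
  have /existsNP[N /forall2NP hN] := nK K%:R.
  by exists N => // n /= Nn; case: (hN n) => [/(_ Nn)//|/negP]; rewrite -ltNge.
Qed.

End recurrence.

(** * Lower integrals *)

Section lower_integral.
Context {R : realType} dT (T : measurableType dT).
Import HBNNSimple.

(** The integral of a nonnegative function is by definition a supremum over simple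
    functions. *)
Lemma ge0_integral_le_nnsfun (m : {measure set T -> \bar R}) (g : T ->
  \bar R) (c : \bar R) :
  (forall x, 0 <= g x)%E ->
  (forall h : {nnsfun T >-> R}, (forall x, ((h x)%:E <= g x)%E) ->
    (\int[m]_x (h x)%:E <= c)%E) ->
  (\int[m]_x g x <= c)%E.
Proof.
move=> g0 H; rewrite ge0_integralTE//; apply: ge_ereal_sup => _ [h hg <-].
by rewrite -integralT_nnsfun; exact: H.
Qed.

Lemma nnsfun_le_ge0_integral (m : {measure set T -> \bar R}) (g : T -> \bar R)
    (h : {nnsfun T >-> R}) :
  (forall x, ((h x)%:E <= g x)%E) -> (\int[m]_x (h x)%:E <= \int[m]_x g x)%E.
Proof.
move=> hg; rewrite [leRHS]ge0_integralTE; last first.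
  by move=> x; apply: le_trans (hg x); rewrite lee_fin.
by apply: ereal_sup_ubound; exists h => //; rewrite -integralT_nnsfun.
Qed.

(** If c > 0, choose simple functions h n <= g n with integrals above some r > 0;
    they tend to 0 and are bounded by 1, against dominated convergence. *)
Lemma lower_integral_cvg0 (m : probability T R) (g : nat -> T -> R) (c : \bar R) :
  (forall n x, 0 <= g n x <= 1) ->
  (forall x, g n x @[n --> \oo] --> 0) ->
  (forall n, \int[m]_x (g n x)%:E = c)%E -> c = 0%E.
Proof.
move=> g01 gcvg gc; apply/eqP; rewrite eq_le; apply/andP; split; last first.
  by rewrite -(gc 0%N) integral_ge0// => x _; rewrite lee_fin; case/andP: (g01 0%N x).
rewrite leNgt; apply/negP => c0.
have [r /andP[r0 rc]] : exists r : R, (0 < r%:E < c)%E.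
  case: c c0 {gc} => [r| |//].
    by rewrite lte_fin => r0; exists (r / 2); rewrite !lte_fin; apply/andP; split; lra.
  by exists 1; rewrite lte_fin ltr01 ltry.
have H n : exists h : {nnsfun T >-> R}, (forall x, h x <= g n x) /\
    (r%:E < \int[m]_x (h x)%:E)%E.
  apply: contrapT => /forallNP nh; move: rc; rewrite ltNge => /negP; apply.
  rewrite -(gc n); apply: ge0_integral_le_nnsfun => [x|h hg].
    by rewrite lee_fin; case/andP: (g01 n x).
  rewrite leNgt; apply/negP => rh; apply: (nh h); split; last exact: rh.
  by move=> x; have := hg x; rewrite lee_fin.
have /choice[h hP] := H.
have h_cvg : (\int[m]_x (h n x)%:E)%E @[n --> \oo] --> (\int[m]_x (cst 0 x))%E.
  have := @dominated_convergence _ _ _ m setT measurableT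
    (fun n x => (h n x)%:E) (cst 0%E) (cst 1%E).
  case => //.
  - by move=> n; apply/measurable_EFinP.
  - apply: aeW => x _; apply/fine_cvgP; split; first exact: nearW.
    apply: (@squeeze_cvgr _ _ _ _ (fun=> 0) (fun n => g n x)) => //.
      by apply: nearW => n /=; rewrite fun_ge0 (hP n).1.
    exact: cvg_cst.
  - exact: finite_measure_integrable_cst.
  - apply: aeW => x n _ /=; rewrite lee_fin ger0_norm ?fun_ge0//.
    by rewrite (le_trans ((hP n).1 x))//; case/andP: (g01 n x).
move: h_cvg; rewrite integral0 => h_cvg.
have : (r%:E <= 0)%E.
  rewrite -(cvg_lim _ h_cvg)//; apply: lime_ge; first by apply/cvg_ex; eexists;
    exact: h_cvg.
  by apply: nearW => n; apply: ltW; exact: (hP n).2.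
by rewrite leNgt => /negP; apply.
Qed.

(** A simple function below g1 may be cut off outside the point a, and is then below
    g2, with the same integral. *)
Lemma le_integral_dirac (a : T) (g1 g2 : T -> \bar R) :
  measurable [set a] -> (forall x, 0 <= g1 x)%E -> (forall x, 0 <= g2 x)%E ->
  g1 a = g2 a -> (\int[\d_a]_x g1 x <= \int[\d_a]_x g2 x)%E.
Proof.
move=> ma g10 g20 ga; apply: ge0_integral_le_nnsfun => // h hg.
pose h' : {nnsfun T >-> R} := proj_nnsfun h ma.
have h'E x : h' x = h x * \1_[set a] x by rewrite /h' /= mindicE indicE.
have h'g x : ((h' x)%:E <= g2 x)%E.
  rewrite h'E indicE; have [|_] := boolP (x \in [set a]); last by rewrite mulr0.
  by rewrite inE => ->; rewrite mulr1 -ga.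
apply: le_trans (nnsfun_le_ge0_integral _ h'g).
rewrite !integral_dirac//; try exact/measurable_EFinP.
by rewrite h'E indicE mem_set// mulr1.
Qed.

Lemma eq_integral_dirac (a : T) (g1 g2 : T -> \bar R) :
  measurable [set a] -> g1 a = g2 a ->
  (\int[\d_a]_x g1 x = \int[\d_a]_x g2 x)%E.
Proof.
move=> ma ga; rewrite integralE [RHS]integralE.
have pa : (g1^\+ a = g2^\+ a)%E by rewrite !funeposE ga.
have na : (g1^\- a = g2^\- a)%E by rewrite !funenegE ga.
by congr (_ - _)%E; apply/eqP; rewrite eq_le; apply/andP; split; apply: le_integral_dirac.
Qed.

End lower_integral.

Section laws.
Context {R : realType} d' (Omega : measurableType d') (P : probability Omega R).

Lemma bounded_cvg_integral (f : nat -> Omega -> R) (l M : R) :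
  (forall n, measurable_fun setT (f n)) -> (forall n w, `|f n w| <= M) ->
  {ae P, forall w, f n w @[n --> \oo] --> l} ->
  (\int[P]_w (f n w)%:E)%E @[n --> \oo] --> l%:E.
Proof.
move=> mf fM fl.
have := @dominated_convergence _ _ _ P setT measurableT
  (fun n w => (f n w)%:E) (cst l%:E) (cst M%:E).
case => //.
- by move=> n; apply/measurable_EFinP.
- apply: filterS fl => w fl _; apply/fine_cvgP; split; first exact: nearW.
  exact: fl.
- exact: finite_measure_integrable_cst.
- by apply: aeW => w n _ /=; rewrite lee_fin.
- move=> _ _; rewrite integral_cst// [X in (_ * X)%E](_ : _ = 1%E) ?mule1//.
  exact: probability_setT.
Qed.

End laws.

(** * Topology and Borel sets of the space of square-integrable fields *)

Section L2topology.
Context {R : realType} (d : nat) (O : polydom R d).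
Implicit Types (u w : L2field O) (f : L2field O -> R).

Lemma L2openE (U : set (L2field O)) : open U = L2open U.
Proof. by []. Qed.

Lemma cvg_L2zero (x : nat -> L2field O) :
  L2dist (L2zero O) (x n) @[n --> \oo] --> 0 -> x n @[n --> \oo] --> L2zero O.
Proof.
move=> x0 A; rewrite nbhsE => -[U [oU U0] UA].
have [e e0 eU] := oU _ U0.
move/cvgr0Pnorm_lt : x0 => /(_ _ e0); apply: filterS => n.
by rewrite ger0_norm; [move=> /eU/UA|rewrite L2dist0E L2nrm_ge0].
Qed.

Lemma measurable_Cb f : continuous f ->
  measurable_fun setT (f : L2borel O -> R).
Proof.
move=> cf; apply: (measurability _ (RGenOInfty.measurableE R)).
move=> _ [_ [x ->] <-]; rewrite setTI.
apply: sub_sigma_algebra; apply: open_comp; first by move=> u _; exact: cf.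
rewrite set_itvE; exact: open_gt.
Qed.

Lemma measurable_L2zero : measurable ([set L2zero O] : set (L2borel O)).
Proof.
rewrite -[X in measurable X]setCK; apply: measurableC.
apply: sub_sigma_algebra; rewrite L2openE => u /= u0.
exists (L2dist u (L2zero O)).
  rewrite lt_def; apply/andP; split; last by rewrite L2distE L2nrm_ge0.
  by apply/eqP => /L2dist_eq0.
by move=> w uw w0; move: uw; rewrite w0 ltxx.
Qed.

(** The bounded continuous function that detects the mass away from 0. *)
Definition capped (u : L2field O) : R := Num.min 1 (L2dist (L2zero O) u).

Lemma L2dist_ge0 u w : 0 <= L2dist u w.
Proof. by rewrite L2distE L2nrm_ge0. Qed.

Lemma L2dist_lip u w : `|L2dist (L2zero O) u - L2dist (L2zero O) w| <= L2dist u w.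
Proof.
rewrite ler_norml; apply/andP; split.
  by have := L2dist_triangle u (L2zero O) w; lra.
by have := L2dist_triangle w (L2zero O) u; rewrite (L2distC w); lra.
Qed.

Lemma capped_ge0 u : 0 <= capped u.
Proof. by rewrite le_min ler01 L2dist_ge0. Qed.

Lemma capped_le1 u : capped u <= 1.
Proof. by rewrite ge_min lexx. Qed.

Lemma Cb_capped : Cb capped.
Proof.
split; last first.
  by exists 1 => u; rewrite ger0_norm ?capped_ge0// capped_le1.
have cd : continuous (fun u => L2dist (L2zero O) u).
  apply/continuousP => A oA; rewrite L2openE => u /= Au.
  have /nbhs_ballP[e /= e0 eA] : nbhs (L2dist (L2zero O) u) A by exact: open_nbhs_nbhs.
  exists e => // w uw; apply: eA; rewrite /ball /=.
  exact: le_lt_trans (L2dist_lip _ _) uw.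
have c1 : continuous (fun _ : L2field O => 1 : R) by exact: cst_continuous.
by move=> u; exact: (continuous_min (c1 u) (cd u)).
Qed.

End L2topology.

(** * Weak convergence of averaged laws *)

Section laws_L2.
Context {R : realType} (d : nat) (O : polydom R d).
Context d' (Omega : measurableType d') (P : probability Omega R).

Lemma Cb_comp_measurable (f : L2field O -> R) (X : Omega -> L2field O) :
  Cb f -> measurable_fun setT (X : Omega -> L2borel O) ->
  measurable_fun setT (fun w => f (X w)).
Proof.
by move=> [cf _] mX; exact: (measurableT_comp (measurable_Cb cf) mX).
Qed.

Lemma Cb_cvg_integral (f : L2field O -> R) (X : nat -> Omega -> L2field O) :
  Cb f -> (forall n, measurable_fun setT (X n : Omega -> L2borel O)) ->
  {ae P, forall w, X n w @[n --> \oo] --> L2zero O} ->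
  (\int[P]_w (f (X n w))%:E)%E @[n --> \oo] --> (f (L2zero O))%:E.
Proof.
move=> Cf mX Xcvg; have [cf [M fM]] := Cf.
apply: (@bounded_cvg_integral _ _ _ _ _ _ M) => //.
  by move=> n; exact: Cb_comp_measurable.
by apply: filterS Xcvg => w Xw; apply: continuous_cvg => //; exact: cf.
Qed.

Variables (X : nat -> Omega -> L2field O).
Hypothesis mX : forall n, measurable_fun setT (X n : Omega -> L2borel O).

Lemma ge0_integral_mean_law (g : L2field O -> R) N :
  measurable_fun setT (g : L2borel O -> R) -> (forall u, 0 <= g u) ->
  (\int[mean_law P X N]_u (g u)%:E =
   (N%:R^-1)%:E * \sum_(n < N) \int[P]_w (g (X n w))%:E)%E.
Proof.
move=> mg g0.
have N0 : 0 <= (N%:R^-1 : R) by rewrite invr_ge0.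
have -> : mean_law P X N = mscale (NngNum N0)
  (msum (fun n => measure_function_pushforward__canonical__measure_function_Measure P
    (mX n)) N).
  by [].
have mEg : measurable_fun setT (fun u : L2borel O => (g u)%:E).
  exact/measurable_EFinP.
rewrite ge0_integral_mscale//; last by move=> u _; rewrite lee_fin.
congr (_ * _)%E; rewrite ge0_integral_measure_sum//; last first.
  by move=> u _; rewrite lee_fin.
apply: eq_bigr => n _; rewrite ge0_integral_pushforward//.
by move=> u _; rewrite lee_fin.
Qed.

(** The mean law is a scaled sum of image measures, so the integral of a nonnegative
    test function is an arithmetic mean of convergent expectations; split a general
    test function into its positive and negative parts. *)
Lemma mean_law_weak_cvg :
  {ae P, forall w, X n w @[n --> \oo] --> L2zero O} ->
  weak_cvg (mean_law P X) (\d_(L2zero O : L2borel O)).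
Proof.
move=> Xcvg f Cf; have [cf [M fM]] := Cf.
have mf := measurable_Cb cf.
rewrite integral_dirac//; last exact/measurable_EFinP.
rewrite diracT mul1e.
have ge0_case (g : L2field O -> R) : Cb g -> (forall u, 0 <= g u) ->
    (\int[mean_law P X N]_u (g u)%:E)%E @[N --> \oo] --> (g (L2zero O))%:E.
  move=> Cg g0; have [cg [L gL]] := Cg.
  pose a n := fine (\int[P]_w (g (X n w))%:E)%E.
  have aE n : (\int[P]_w (g (X n w))%:E)%E = (a n)%:E.
    rewrite /a fineK// integrable_fin_num//.
    apply: measurable_bounded_integrable => //.
    - by rewrite (le_lt_trans (probability_le1 _ _)) ?ltry.
    - exact: Cb_comp_measurable.
    - by exists L; split; [exact: num_real|move=> x Lx w _ /=;
      rewrite (le_trans (gL _))// ltW].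
  have acvg : a n @[n --> \oo] --> g (L2zero O).
    have := Cb_cvg_integral Cg mX Xcvg.
    by under eq_fun do rewrite aE; move=> /fine_cvgP[].
  rewrite -(cvg_shiftS (fun N => (\int[mean_law P X N]_u (g u)%:E)%E)).
  have E N : (\int[mean_law P X N.+1]_u (g u)%:E)%E = (arithmetic_mean a N)%:E.
    rewrite ge0_integral_mean_law//; last exact: measurable_Cb.
    rewrite /arithmetic_mean /= EFinM; congr (_ * _)%E.
    rewrite /series /= big_mkord -sumEFin; apply: eq_bigr => n _; exact: aE.
  under eq_fun do rewrite E.
  by apply/fine_cvgP; split; [exact: nearW|exact: cesaro].
pose fp u := Num.max (f u) 0; pose fn u := Num.max (- f u) 0.
have c0 : continuous (fun _ : L2field O => 0 : R) by exact: cst_continuous.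
have Cfp : Cb fp.
  split; first by move=> u; exact: (continuous_max (cf u) (c0 u)).
  exists M => u; rewrite /fp; have := fM u; have := normr_ge0 (f u).
  by rewrite /Num.max; case: ifP; rewrite ?normr0; lra.
have Cfn : Cb fn.
  split; first by move=> u; exact: (continuous_max (continuousN (cf u)) (c0 u)).
  exists M => u; rewrite /fn; have := fM u; have := normr_ge0 (f u).
  by rewrite /Num.max; case: ifP; rewrite ?normr0 ?normrN; lra.
have fp0 u : 0 <= fp u by rewrite le_max lexx orbT.
have fn0 u : 0 <= fn u by rewrite le_max lexx orbT.
have E N : (\int[mean_law P X N]_u (f u)%:E =
    \int[mean_law P X N]_u (fp u)%:E - \int[mean_law P X N]_u (fn u)%:E)%E.
  have N0 : 0 <= (N%:R^-1 : R) by rewrite invr_ge0.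
  have -> : mean_law P X N = mscale (NngNum N0) (msum (fun n =>
      measure_function_pushforward__canonical__measure_function_Measure P (mX n)) N).
    by [].
  rewrite integralE; congr (_ - _)%E; apply: eq_integral => u _.
    by rewrite funeposE -EFin_max.
  by rewrite funenegE -EFinN -EFin_max.
have -> : (f (L2zero O))%:E = ((fp (L2zero O))%:E - (fn (L2zero O))%:E)%E.
  rewrite -EFinB /fp /fn; congr EFin; rewrite /Num.max oppr_lt0.
  by case: (ltgtP (f (L2zero O)) 0) => h; lra.
under eq_fun do rewrite E.
by apply: cvgeB => //; exact: ge0_case.
Qed.

End laws_L2.

(** * Measurability of reconstructed random variables *)

Section rvar_L2.
Context {R : realType} (d : nat) (O : polydom R d) (p : R).
Hypotheses (hp : 1 < p).
Variables (D : GD O) (hD : is_GD p D).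
Context d' (Omega : measurableType d') (P : probability Omega R).

(** The reconstruction is continuous in the coordinates, so the preimage of an open
    set of fields is an open set of coordinate vectors. *)
Lemma measurable_Pi (X : Omega -> XD D) : rvar X ->
  measurable_fun setT ((fun w => PiD (X w)) : Omega -> L2borel O).
Proof.
move=> rX.
have mc : measurable_fun setT (fun w => v2r (X w)).
  apply: measurable_fun_mxP => i j; rewrite (ord1 i).
  pose l0 (v : XD D) : R^o := v2r v 0 j.
  have l0_lin : linear l0 by move=> a u v; rewrite /l0 linearP !mxE.
  pose l : {linear XD D -> R^o} := HB.pack l0 (GRing.isLinear.Build _ _ _ _ l0 l0_lin).
  exact: (rX l).
apply: (@measurability _ _ _ (L2borel O) _ _ (@open (L2field O))) => //.
move=> _ [U oU <-]; rewrite setTI.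
have -> : (fun w => PiD (X w)) @^-1` U = (fun w => v2r (X w)) @^-1` [set c | U (PiD
  (r2v c : XD D))].
  by apply/seteqP; split => w /=; rewrite v2rK.
rewrite -[X in measurable X]setTI; apply: mc => //.
apply: open_measurable_rV; rewrite openE => c /= Uc.
have [e e0 eU] := oU _ Uc.
have cc : (fun t : 'rV[R]_(dim (XD D)) => t) @ c --> c by exact: cvg_id.
have sp := PiD_nrm_seminorm hD.
have C0 : 0 < seminorm_bound (@PiD_nrm _ _ _ D) + 1.
  by rewrite ltr_wpDl// (seminorm_bound_ge0 sp).
have := @cvgr_dist_lt _ _ _ _ (nbhs_filter c) _ _ cc _ (divr_gt0 e0 C0).
rewrite /interior/=; apply: filterS => c' /=; rewrite ltr_pdivlMr// => cc'.
apply: eU; rewrite (L2dist_Pi hD) -linearB; apply: le_lt_trans cc'.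
rewrite (le_trans (seminorm_le sp _))// /coord_nrm r2vK mulrC ler_wpM2l//.
by rewrite lerDl.
Qed.

End rvar_L2.

(** * The scheme driven by a Wiener process *)

Section wiener.
Context {R : realType} d' (Omega : measurableType d') (P : probability Omega R).

Lemma Wiener_recurrent (F : R -> set_system Omega) (W : R -> Omega -> R) (tau : R) :
  usual_filtration P F -> Wiener P F W -> 0 < tau ->
  {ae P, forall w, exists K, forall N, exists2 n, (N <= n)%N &
    `|W (n.+1%:R * tau) w - W (n%:R * tau) w| <= K}.
Proof.
move=> [Fm _ _ _] [_ _ adapted law _] tau0.
have t0 n : 0 <= n%:R * tau by rewrite mulr_ge0// ltW.
have mW n : measurable_fun setT (W (n%:R * tau)).
  move=> _ B mB; rewrite setTI; apply: (Fm _ (t0 n)).2.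
  exact: adapted.
apply: (@identically_distributed_recurrent _ _ _ P
  (fun n w => W (n.+1%:R * tau) w - W (n%:R * tau) w)).
  by move=> n; exact: measurable_funB.
have lawE n B : measurable B ->
    P [set w | B (W (n.+1%:R * tau) w - W (n%:R * tau) w)] =
    normal_prob 0 (Num.sqrt tau) B.
  move=> mB.
  have lt : n%:R * tau < n.+1%:R * tau by rewrite ltr_pM2r// ltr_nat.
  have := law _ _ (t0 n) lt B mB.
  have -> : n.+1%:R * tau - n%:R * tau = tau by rewrite -natr1; ring.
  by [].
by move=> n B mB; apply: etrans (lawE n B mB) _; apply: esym; exact: lawE.
Qed.

End wiener.

Section scheme.
Context {R : realType} (d : nat) (O : polydom R d) (p kappa : R).
Hypotheses (hp : 1 < p) (hkappa : 0 <= kappa).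
Variables (sigma : mxfield R O 1 d) (hsigma : W1oo_div sigma).
Variables (D : GD O) (hD : is_GD p D).
Context d' (Omega : measurableType d') (P : probability Omega R).
Variables (F : R -> set_system Omega) (hF : usual_filtration P F).
Variables (W : R -> Omega -> R) (hW : Wiener P F W).
Variables (tau : R) (htau : 0 < tau).

Lemma initialised_E0 vin (v0 : XD D) (q0 : YD D) : initialised vin v0 q0 -> E0 v0.
Proof.
move=> [_ _ h] q Yq; rewrite -(h q Yq); apply: eq_Rintegral => x _.
by rewrite mulrC.
Qed.

Lemma initialised_zero (v0 : XD D) (q0 : YD D) :
  initialised (L2zero O) v0 q0 -> PiD_nrm v0 = 0.
Proof.
move=> ini; have Ev := initialised_E0 ini; have [Yq h _] := ini.
apply/eqP; rewrite -sqrf_eq0 PiD_nrm_sqr; apply/eqP.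
have := h v0; rewrite [scpair _ _ _](_ : _ = 0) ?addr0; last exact: Ev.
rewrite -/(PiD_pair v0 v0) => ->; apply: ae_mxpair_eq0; try exact: measurable_mxfield.
exact: field0P.
Qed.

Section trajectories.
Variables (vin : L2field O) (v : nat -> Omega -> XD D) (q : nat -> Omega -> YD D).
Hypothesis hv : algorithm p P kappa sigma tau W vin v q.

Let steps : {ae P, forall w n,
  time_step p kappa sigma tau (W (n.+1%:R * tau) w - W (n%:R * tau) w)
    (v n w) (v n.+1 w) (q n w) (q n.+1 w)}.
Proof. by have [_ _ _ h] := hv; exact: ae_foralln. Qed.

Lemma algorithm_cvg :
  {ae P, forall w, PiD (v n w) @[n --> \oo] --> L2zero O}.
Proof.
have [_ Yq ini _] := hv.
move: steps (Wiener_recurrent hF hW htau); apply: filterS2 => w st rec.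
apply: cvg_L2zero; under eq_fun do rewrite L2dist0E.
exact: (trajectory_cvg hp hkappa hsigma hD htau (Yq ^~ w) (initialised_E0 (ini w)) st
  rec).
Qed.

Lemma algorithm_midpoint_cvg :
  {ae P, forall w, PiD (midpoint (v n w) (v n.+1 w)) @[n --> \oo] --> L2zero O}.
Proof.
have [_ Yq ini _] := hv.
apply: filterS steps => w st.
apply: cvg_L2zero; under eq_fun do rewrite L2dist0E.
exact: (PiD_nrm_midpoint_cvg hp hkappa hD htau (Yq ^~ w) st).
Qed.

Lemma measurable_algorithm n :
  measurable_fun setT ((fun w => PiD (v n w)) : Omega -> L2borel O).
Proof. by have [h _ _ _] := hv; apply: (measurable_Pi hD); exact: (h n).1. Qed.

Lemma measurable_algorithm_midpoint n : measurable_fun setT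
  ((fun w => PiD (midpoint (v n w) (v n.+1 w))) : Omega -> L2borel O).
Proof.
have [h _ _ _] := hv; apply: (measurable_Pi hD) => l.
under eq_fun do rewrite /midpoint linearZ linearD.
apply: measurable_funM => //.
by apply: measurable_funD; [exact: (h n.+1).1|exact: (h n).1].
Qed.

End trajectories.

(** Zero initial data have zero discrete energy, which cannot increase. *)
Lemma algorithm_zero (v : nat -> Omega -> XD D) (q : nat -> Omega -> YD D) n :
  algorithm p P kappa sigma tau W (L2zero O) v q ->
  {ae P, forall w, PiD (v n w) = L2zero O}.
Proof.
move=> [_ Yq ini h]; have := ae_foralln h; apply: filterS => w st.
have Ev := initialised_E0 (ini w).
apply: esym; apply: L2dist_eq0; rewrite L2dist0E.
apply/eqP; rewrite eq_le L2nrm_ge0 andbT.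
have := trajectory_decreasing hp hD htau (Yq ^~ w) st (leq0n n).
by rewrite (initialised_zero (ini w)).
Qed.

(** * Invariant measures *)

Section invariance.
Variables (S : L2field O -> nat -> Omega -> XD D) (q : L2field O -> nat -> Omega -> YD D).
Hypothesis hS : forall u, algorithm p P kappa sigma tau W u (S u) (q u).

Lemma dirac_invariant (m : probability (L2borel O) R) :
  (forall A, measurable A -> m A = \d_(L2zero O : L2borel O) A) ->
  invariant_measure P S m.
Proof.
move=> mE n f n0 Cf.
have mE' (g : L2borel O -> \bar R) : (\int[m]_u g u = \int[\d_(L2zero O :
  L2borel O)]_u g u)%E.
  by apply: eq_measure_integral => A mA _; exact: mE.
rewrite !mE'; apply: eq_integral_dirac; first exact: measurable_L2zero.
rewrite /transition_semigroup unlock; congr EFin.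
rewrite (@ae_eq_integral _ _ _ P setT (cst (f (L2zero O))%:E))//.
- rewrite integral_cst// [X in (_ * X)%E](_ : _ = 1%E) ?mule1//.
  exact: probability_setT.
- by apply/measurable_EFinP; exact: Cb_comp_measurable (measurable_algorithm (hS _) n).
- by apply: filterS (algorithm_zero n (hS (L2zero O))) => w -> _.
Qed.

(** The integral of the capped distance to 0 equals that of its image under the
    semigroup at every positive time, and these images tend to 0 pointwise. *)
Lemma invariant_dirac (m : probability (L2borel O) R) : invariant_measure P S m ->
  forall A, measurable A -> m A = \d_(L2zero O : L2borel O) A.
Proof.
move=> inv.
pose g n := transition_semigroup P S n.+1 (@capped _ _ O).
have gE n u : (g n u)%:E = (\int[P]_w (capped (PiD (S u n.+1 w)))%:E)%E.
  rewrite /g /transition_semigroup unlock fineK// integrable_fin_num//.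
  apply: measurable_bounded_integrable => //.
  - by rewrite (le_lt_trans (probability_le1 _ _)) ?ltry.
  - exact: Cb_comp_measurable (Cb_capped O) (measurable_algorithm (hS _) _).
  - exists 1; split; [exact: num_real|move=> x x1 w _ /=].
    by rewrite ger0_norm ?capped_ge0// (le_trans (capped_le1 _))// ltW.
have capped0 : capped (L2zero O) = 0.
  have z0 := ae_mxpair_eq0 (measurable_mxfield (L2zero O))
    (measurable_mxfield (L2zero O)) (field0P O).
  by rewrite /capped L2dist0E /L2nrm z0 sqrtr0 min_r.
have int0 : (\int[m]_u (capped u)%:E = 0)%E.
  apply: (@lower_integral_cvg0 _ _ _ m g).
  - move=> n u; rewrite -!lee_fin gE; apply/andP; split.
      by apply: integral_ge0 => w _; rewrite lee_fin capped_ge0.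
    have -> : 1%:E = (\int[P]_w (cst 1%:E) w)%E.
      by rewrite integral_cst// mul1e; apply/esym; exact: probability_setT.
    apply: ge0_le_integral => //.
    + by move=> w _; rewrite lee_fin capped_ge0.
    + by apply/measurable_EFinP;
      exact: Cb_comp_measurable (Cb_capped O) (measurable_algorithm (hS _) _).
    + by move=> w _; rewrite lee_fin capped_le1.
  - move=> u; pose a n := (\int[P]_w (capped (PiD (S u n w)))%:E)%E.
    have a0 : a n @[n --> \oo] --> (capped (L2zero O))%:E.
      exact: Cb_cvg_integral (Cb_capped O) (measurable_algorithm (hS u))
        (algorithm_cvg (hS u)).
    have aE n : a n.+1 = (g n u)%:E by rewrite gE.
    clearbody a; move: a0; rewrite -(cvg_shiftS a) capped0.
    by under eq_fun do rewrite aE; move=> /fine_cvgP[].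
  - by move=> n; apply: inv => //; exact: Cb_capped.
have m0 : m (~` [set L2zero O]) = 0%E.
  have mc : measurable_fun setT (fun u : L2borel O => (capped u)%:E).
    by apply/measurable_EFinP; apply: measurable_Cb; have [] := Cb_capped O.
  have : (\int[m]_(u in setT) `|(capped u)%:E| = 0)%E.
    rewrite -[RHS]int0; apply: eq_integral => u _ /=.
    by rewrite ger0_norm// capped_ge0.
  move=> /(ae_eq_integral_abs m measurableT mc) [N [mN N0 hN]].
  apply/eqP; rewrite eq_le measure_ge0 andbT -N0; apply: le_measure; rewrite ?inE//.
    by apply: measurableC; exact: measurable_L2zero.
  move=> u /= u0; apply: hN => /= /(_ I) [].
  rewrite /capped /Num.min; case: ifP => _; first by move/eqP; rewrite oner_eq0.
  by move=> /L2dist_eq0 /esym.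
move=> A mA; rewrite diracE; have mz := @measurable_L2zero _ _ O.
have m1 : m [set L2zero O] = 1%E.
  rewrite -[X in m X]setCK probability_setC ?m0 ?sube0//.
  exact: measurableC.
have [|] := boolP ((L2zero O : L2borel O) \in A).
  rewrite inE => zA; apply/eqP; rewrite eq_le probability_le1//= -m1.
  by apply: le_measure; rewrite ?inE// => u ->.
rewrite notin_setE => zA; rewrite [RHS](_ : _ = 0%E)//.
apply/eqP; rewrite eq_le measure_ge0 andbT -m0.
by apply: le_measure; rewrite ?inE//; [exact: measurableC|move=> u Au /= u0; apply: zA;
  rewrite -u0].
Qed.

End invariance.

End scheme.

Theorem mainTheorem7
  (R : realType) (d : nat) (hd : (0 < d)%N) (O : polydom R d)
  (p kappa : R) (hp : 1 < p) (hkappa : 0 <= kappa)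
  (sigma : mxfield R O 1 d) (hsigma : W1oo_div sigma)
  (D : GD O) (hD : is_GD p D)
  (Gamma : R) (hGamma : 1 <= Gamma) (hstable : stableD p D Gamma)
  (d' : measure_display) (Omega : measurableType d') (P : probability Omega R)
  (F : R -> set_system Omega) (hF : usual_filtration P F)
  (W : R -> Omega -> R) (hW : Wiener P F W)
  (tau : R) (htau : 0 < tau)
  (S : L2field O -> nat -> Omega -> XD D)
  (pi : L2field O -> nat -> Omega -> YD D)
  (hS : forall vin, algorithm p P kappa sigma tau W vin (S vin) (pi vin))
  (vin : L2field O) :
  let v := S vin in
  let Piv n w := PiD (v n w) in
  let Pivhalf n w := PiD (midpoint (v n w) (v n.+1 w)) in
  [/\ (* (a) *)
      forall m : probability (L2borel O) R,
        invariant_measure P S m <->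
        (forall A, measurable A -> m A = \d_(L2zero O : L2borel O) A),
      (* (b) *)
      {ae P, forall w, Piv n w @[n --> \oo] --> L2zero O},
      (* (c) *)
      {ae P, forall w, Pivhalf n w @[n --> \oo] --> L2zero O},
      (* (d) *)
      weak_cvg (mean_law P Piv) (\d_(L2zero O : L2borel O)) &
      (* (e) *)
      weak_cvg (mean_law P Pivhalf) (\d_(L2zero O : L2borel O))].
Proof.
have cvg_v := algorithm_cvg hp hkappa hsigma hD hF hW htau (hS vin).
have cvg_mid := algorithm_midpoint_cvg hp hkappa hD htau (hS vin).
move=> v Piv Pivhalf; split=> //.
- move=> m; split.
    exact: (invariant_dirac hp hkappa hsigma hD hF hW htau hS).
  exact: (dirac_invariant hp hD htau hS).
- exact: (mean_law_weak_cvg (measurable_algorithm hD (hS vin)) cvg_v).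
- exact: (mean_law_weak_cvg (measurable_algorithm_midpoint hD (hS vin)) cvg_mid).
Qed.
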